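(* Let $R$ be a Prüfer domain, $\mathcal C$ the class of all finitely presented $R$-modules, $\mathcal C_{\mathrm{tor}}$ the class of finitely presented torsion modules, and $\mathcal C_{\mathrm{proj}}$ the class of finitely generated projective modules. 1. $\mathcal V(\mathcal C)=\mathcal V(\mathcal C_{\mathrm{proj}})\times\mathcal V(\mathcal C_{\mathrm{tor}})$. 2. If $R$ has the $1\frac12$ generator property, then $\mathcal V(\mathcal C_{\mathrm{proj}})$ is finitely primary of rank $1$ and exponent $1$. 3. Assume, in addition, that $R$ is $h$-local. Then $\mathcal V(\mathcal C_{\mathrm{tor}})$ is free abelian and $\mathcal V(\mathcal C)$ is half-factorial. Furthermore, $\mathcal V(\mathcal C)$ is either factorial or $\mathsf c\big(\mathcal V(\mathcal C)\big)=\mathsf t\big(\mathcal V(\mathcal C)\big)=2$.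
   Context: A Prüfer domain is an integral domain in which every nonzero finitely generated ideal is invertible. A commutative ring $R$ has the $1\frac12$ generator property if, for any invertible ideal $I\subset R$ and any regular element $a\in I\setminus\mathrm{rad}(R)I$ ($\mathrm{rad}(R)$ the Jacobson radical), there exists $b\in R$ with $I=Ra+Rb$. An integral domain is $h$-local if each nonzero element is contained in at most finitely many maximal ideals and each nonzero prime ideal is contained in a unique maximal ideal. For a class $\mathcal C$ of modules closed under finite direct sums, direct summands and isomorphisms, $\mathcal V(\mathcal C)$ is the set of isomorphism classes $[M]$ with operation $[M]+[N]=[M\oplus N]$. The product in part 1 is the internal direct product: every element of $\mathcal V(\mathcal C)$ is uniquely a sum of an element of $\mathcal V(\mathcal C_{\mathrm{proj}})$ and an element of $\mathcal V(\mathcal C_{\mathrm{tor}})$. Monoid: commutative cancellative semigroup with identity. A monoid $H$ is finitely primary of rank $s$ and exponent $\alpha$ ($s,\alpha\in\mathbb N$) if $H$ is a submonoid of a factorial monoid $F=F^\times\times[p_1,\ldots,p_s]$ with $s$ pairwise non-associated prime elements $p_1,\ldots,p_s$ such that $H\setminus H^\times\subset p_1\cdots p_sF$ and $(p_1\cdots p_s)^\alpha F\subset H$. Factorizations: $H_{\mathrm{red}}=\{aH^\times:a\in H\}$; $\mathsf Z(a)$ is the set of factorizations of $aH^\times$ into atoms of $H_{\mathrm{red}}$ (formal products, up to order); $|z|$ is the number of factors; $\mathsf L(a)=\{|z|:z\in\mathsf Z(a)\}$. $H$ is factorial if $|\mathsf Z(a)|=1$ for all $a$, and half-factorial if it is atomic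 and $|\mathsf L(a)|=1$ for all $a$. $\mathsf d(z,z')=\max\{|z\gcd(z,z')^{-1}|,|z'\gcd(z,z')^{-1}|\}$. $\mathsf c(a)$ is the smallest $N\in\mathbb N_0\cup\{\infty\}$ such that any $z,z'\in\mathsf Z(a)$ can be joined by a finite chain in $\mathsf Z(a)$ with consecutive distances $\le N$; $\mathsf c(H)=\sup_a\mathsf c(a)$. For an atom $u\in H_{\mathrm{red}}$, $\mathsf t(H,u)$ is the smallest $N\in\mathbb N_0\cup\{\infty\}$ such that for every multiple $a\in H_{\mathrm{red}}$ of $u$ and every factorization $v_1\cdots v_n\in\mathsf Z(a)$ not containing $u$, there is (after renumbering) a subproduct $v_1\cdots v_m$ that is a multiple of $u$ and a refactorization $v_1\cdots v_m=uu_2\cdots u_\ell$ into atoms with $\max\{\ell,m\}\le N$; $\mathsf t(H)=\sup_u\mathsf t(H,u)$. *)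

(* Defs.v *)
From HB Require Import structures.
From mathcomp Require Import all_boot all_algebra finmap multiset.
From mathcomp Require Import boolp classical_sets cardinality.

Set Implicit Arguments.
Unset Strict Implicit.
Unset Printing Implicit Defensive.

Import GRing.Theory.

Local Open Scope ring_scope.
Local Open Scope quotient_scope.
Local Open Scope classical_set_scope.

(** * Values in N_0 ∪ {∞} *)

(* [None] stands for ∞. *)
Definition enat := option nat.

Definition enat_le (x : enat) (n : nat) : bool :=
  if x is Some k then (k <= n)%N else false.

Lemma ex_asbool (A : set nat) : (exists n, A n) -> exists n, `[<A n>].
Proof. by move=> [n An]; exists n; apply/asboolP. Qed.

Definition einf (A : set nat) : enat :=
  if pselect (exists n, A n) is left h then Some (ex_minn (ex_asbool h))
  else None.

(* Upper bounds other than ∞ are natural numbers, so the supremum is the least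
   natural upper bound, or ∞ if there is none. *)
Definition esup (A : set enat) : enat :=
  einf [set n | forall x, A x -> enat_le x n].

(** * Commutative monoids, written additively *)

Section Monoid.
Variable H : nmodType.
Implicit Types a b p : H.

Definition cancellative := forall a b c : H, a + b = a + c -> b = c.

Definition munit : set H := [set a | exists b, a + b = 0].

Definition mdvd a b := exists c, b = a + c.

Definition massoc a b := exists2 u, munit u & b = a + u.

Definition matom : set H :=
  [set a | ~ munit a /\ forall b c, a = b + c -> munit b \/ munit c].

Definition mprime : set H :=
  [set p | ~ munit p /\ forall a b, mdvd p (a + b) -> mdvd p a \/ mdvd p b].

Lemma munit0 : munit 0. Proof. by exists 0; rewrite addr0. Qed.

Lemma munitD a b : munit a -> munit b -> munit (a + b).
Proof. by move=> [c ac] [d bd]; exists (c + d); rewrite addrACA ac bd addr0. Qed.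

Definition massocb a b : bool := `[<massoc a b>].

Lemma massocb_refl : reflexive massocb.
Proof. by move=> a; apply/asboolP; exists 0; rewrite ?addr0//; exact: munit0. Qed.

Lemma massocb_sym : symmetric massocb.
Proof.
suff S a b : massocb a b -> massocb b a by move=> a b; apply/idP/idP; exact: S.
move=> /asboolP[u [v uv] ->]; apply/asboolP; exists v.
  by exists u; rewrite addrC.
by rewrite -addrA uv addr0.
Qed.

Lemma massocb_trans : transitive massocb.
Proof.
move=> b a c /asboolP[u uu ->] /asboolP[v vv ->]; apply/asboolP.
by exists (u + v); [exact: munitD | rewrite addrA].
Qed.

Canonical massoc_equiv := EquivRel massocb massocb_refl massocb_sym massocb_trans.

(* H_red = {a + H^× : a ∈ H}: the classes for [massoc] are exactly the sets
   a + H^×. *)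
Definition reduced := {eq_quot massoc_equiv}.

HB.instance Definition _ := EqQuotient.on reduced.
HB.instance Definition _ := Choice.on reduced.

Definition red (a : H) : reduced := \pi_reduced a.

Definition reduced_add (x y : reduced) : reduced := red (repr x + repr y).

Lemma redP a b : red a = red b <-> massoc a b.
Proof.
split; first by move=> /eqquotP /asboolP.
by move=> ab; apply/eqquotP/asboolP.
Qed.

Lemma redD a b : reduced_add (red a) (red b) = red (a + b).
Proof.
have /redP[u uu ea] : red a = red (repr (red a)) by rewrite /red reprK.
have /redP[v vv eb] : red b = red (repr (red b)) by rewrite /red reprK.
apply/esym/redP; exists (u + v); first exact: munitD.
by rewrite ea eb addrACA.
Qed.

Lemma reduced_addA : associative reduced_add.
Proof.
move=> x y z; rewrite -[x]reprK -[y]reprK -[z]reprK.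
by rewrite -!/(red _) !redD addrA.
Qed.

Lemma reduced_addC : commutative reduced_add.
Proof. by move=> x y; rewrite /reduced_add addrC. Qed.

Lemma reduced_add0 : left_id (red 0) reduced_add.
Proof. by move=> x; rewrite -[x]reprK -!/(red _) redD add0r. Qed.

HB.instance Definition _ :=
  GRing.isNmodule.Build reduced reduced_addA reduced_addC reduced_add0.

End Monoid.

Arguments red {H}.

Section Factorizations.
Local Open Scope mset_scope.
Variable H : nmodType.
Implicit Types (a : H) (x u : reduced H) (z : {mset reduced H}).

Definition factorizations x : set {mset reduced H} :=
  [set z | (forall u, u \in z -> matom u) /\ (\sum_(u <- z) u)%R = x].

Definition Zfact a := factorizations (red a).

Definition lengths a : set nat := [set n | exists2 z, Zfact a z & size z = n].

(* Monoids are cancellative by convention, hence the first conjuncts. *)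
Definition factorial_monoid := cancellative H /\ forall a, exists! z, Zfact a z.

Definition atomic := forall a, exists z, Zfact a z.

Definition half_factorial :=
  [/\ cancellative H, atomic & forall a, exists! n, lengths a n].

Definition fdist z z' : nat :=
  maxn (size (z `\` (z `&` z'))) (size (z' `\` (z `&` z'))).

Definition chain_bound a : set nat :=
  [set N | forall z z', Zfact a z -> Zfact a z' ->
    exists s : seq {mset reduced H},
      [/\ forall y, y \in s -> Zfact a y,
          path (fun y y' => (fdist y y' <= N)%N) z s & last z s = z']].

Definition catenary_degree_at a : enat := einf (chain_bound a).

Definition catenary_degree : enat := esup (range catenary_degree_at).

(* Here w = v_1 ... v_m is the subproduct, and u u_2 ... u_l is the multiset
   obtained by adding u to y = u_2 ... u_l. *)
Definition tame_bound u : set nat :=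
  [set N | forall x v, mdvd u x -> factorizations x v -> u \notin v ->
    exists w y : {mset reduced H},
      [/\ w `<=` v, mdvd u (\sum_(t <- w) t)%R,
          factorizations (\sum_(t <- w) t)%R (u +` y) &
          (maxn (size (u +` y)) (size w) <= N)%N]].

Definition tame_degree_at u : enat := einf (tame_bound u).

Definition tame_degree : enat := esup (tame_degree_at @` @matom (reduced H)).

Definition free_abelian := exists P : set H,
  forall a, exists! z : {mset H},
    (forall p, p \in z -> P p) /\ (\sum_(p <- z) p)%R = a.

End Factorizations.

Definition finitely_primary (H : nmodType) (s alpha : nat) :=
  [/\ (0 < s)%N, (0 < alpha)%N &
    exists (F : nmodType) (i : {additive H -> F}) (p : 'I_s -> F),
    [/\ factorial_monoid F /\ injective i,
        (forall j, mprime (p j)) /\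
          (forall j k, massoc (p j) (p k) -> j = k),
        forall x : F, exists! ue : F * {ffun 'I_s -> nat},
          munit ue.1 /\ x = ue.1 + \sum_j p j *+ ue.2 j,
        forall a : H, ~ munit a -> mdvd (\sum_j p j) (i a) &
        forall y : F, exists a : H, i a = (\sum_j p j) *+ alpha + y]].

(* A is the internal direct product of the images of i and j; injectivity of
   i and j follows from uniqueness. *)
Definition internal_product (A B H : nmodType)
    (i : {additive A -> H}) (j : {additive B -> H}) :=
  forall x : H, exists! ab : A * B, x = i ab.1 + j ab.2.

(** * Ideals *)

(* The set of finite sums of products, for subsets of any commutative ring. *)
Definition set_mul (S : comNzRingType) (A B : set S) : set S :=
  [set x | exists (n : nat) (f g : 'I_n -> S),
    [/\ forall i, A (f i), forall i, B (g i) & x = \sum_i f i * g i]].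

Section Ideals.
Variable R : idomainType.
Implicit Types I J m P : set R.

Definition ideal I := I 0 /\ forall a x y, I x -> I y -> I (a * x + y).

Definition gen_ideal n (g : 'I_n -> R) : set R :=
  [set x | exists c : 'I_n -> R, x = \sum_i c i * g i].

Definition maximal_ideal m :=
  [/\ ideal m, ~ m 1 & forall J, ideal J -> m `<=` J -> J = m \/ J = setT].

Definition prime_ideal P :=
  [/\ ideal P, ~ P 1 & forall a b, P (a * b) -> P a \/ P b].

Definition jacobson_radical : set R :=
  [set x | forall m, maximal_ideal m -> m x].

Definition frac_submodule (J : set {fraction R}) :=
  J 0 /\ forall (a : R) x y, J x -> J y -> J (tofrac a * x + y).

Definition invertible_ideal I := ideal I /\
  exists2 J, frac_submodule J & set_mul (@tofrac R @` I) J = range (@tofrac R).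

Definition prufer := forall n (g : 'I_n -> R),
  gen_ideal g <> [set 0] -> invertible_ideal (gen_ideal g).

Definition one_and_half_generator := forall I (a : R),
  invertible_ideal I -> GRing.lreg a -> I a ->
  ~ set_mul jacobson_radical I a ->
  exists b : R, I = [set x | exists r s, x = r * a + s * b].

Definition h_local :=
  (forall x : R, x != 0 -> finite_set [set m | maximal_ideal m /\ m x]) /\
  (forall P, prime_ideal P -> P <> [set 0] ->
    exists! m, maximal_ideal m /\ P `<=` m).

End Ideals.

(** * Modules *)

Lemma pair_ext (A B : Type) (x y : A * B) : x.1 = y.1 -> x.2 = y.2 -> x = y.
Proof. by case: x y => [a b] [c d] /= -> ->. Qed.

Section Linear.
Variables (R : pzRingType) (U V : lmodType R) (f : U -> V) (f_lin : linear f).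
Definition mk_linear_fun of linear f : U -> V := f.
HB.instance Definition _ := GRing.isLinear.Build R U V *:%R (mk_linear_fun f_lin) f_lin.
Definition mk_linear : {linear U -> V} := mk_linear_fun f_lin.
Lemma mk_linearE x : mk_linear x = f x. Proof. by []. Qed.
End Linear.

Section Modules.
Variable R : idomainType.
Implicit Types M N P : lmodType R.

Definition surj_lin M N (f : {linear M -> N}) := forall y, exists x, f x = y.

Definition mod_iso M N := exists f : {linear M -> N}, bijective f.

Definition fin_generated M := exists n (f : {linear 'rV[R]_n -> M}), surj_lin f.

(* Exactness of R^m -> R^n -> M -> 0. *)
Definition fin_presented M :=
  exists m n (g : {linear 'rV[R]_m -> 'rV[R]_n}) (f : {linear 'rV[R]_n -> M}),
    surj_lin f /\ forall x, f x = 0 <-> exists y, g y = x.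

Definition torsion M := forall x : M, exists2 r : R, r != 0 & r *: x = 0.

Definition projective P := forall M N (p : {linear M -> N}) (f : {linear P -> N}),
  surj_lin p -> exists f' : {linear P -> M}, forall x, p (f' x) = f x.

(* The empty direct sum is represented by R^0. Finite generation makes the
   isomorphism classes in [C] form a small type, see [Vmon] below. *)
Record modClass := ModClass {
  in_class :> lmodType R -> Prop;
  class_fg : forall M, in_class M -> fin_generated M;
  class_iso : forall M N, mod_iso M N -> in_class M -> in_class N;
  class_zero : in_class 'rV[R]_0;
  class_sum : forall M N, in_class M -> in_class N -> in_class (M * N)%type;
  class_summand : forall M N, in_class (M * N)%type -> in_class M }.

Lemma iso_refl M : mod_iso M M.
Proof. by exists idfun; exists idfun. Qed.

Lemma iso_sym M N : mod_iso M N -> mod_iso N M.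
Proof.
move=> [f [g fK gK]].
have gl : linear g.
  by move=> a x y; apply: (can_inj fK); rewrite gK linearP !gK.
by exists (mk_linear gl); exists f.
Qed.

Lemma iso_trans M N P : mod_iso M N -> mod_iso N P -> mod_iso M P.
Proof. by move=> [f bf] [g bg]; exists (g \o f); exact: bij_comp. Qed.

Lemma iso_sum M N M' N' :
  mod_iso M M' -> mod_iso N N' -> mod_iso (M * N)%type (M' * N')%type.
Proof.
move=> [f [f' fK f'K]] [g [g' gK g'K]].
pose h (x : (M * N)%type) : (M' * N')%type := (f x.1, g x.2).
have hl : linear h by move=> a x y; rewrite /h /= !linearP.
exists (mk_linear hl), (fun x => (f' x.1, g' x.2)).
- by move=> [x y]; rewrite mk_linearE /h /= fK gK.
- by move=> [x y]; rewrite mk_linearE /h /= f'K g'K.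
Qed.

Lemma iso_sumC M N : mod_iso (M * N)%type (N * M)%type.
Proof.
pose h (x : (M * N)%type) : (N * M)%type := (x.2, x.1).
have hl : linear h by [].
by exists (mk_linear hl), (fun x => (x.2, x.1)); case.
Qed.

Lemma iso_sumA M N P : mod_iso (M * (N * P))%type (M * N * P)%type.
Proof.
pose h (x : (M * (N * P))%type) : (M * N * P)%type := ((x.1, x.2.1), x.2.2).
have hl : linear h by [].
exists (mk_linear hl), (fun x => (x.1.1, (x.1.2, x.2))).
- by move=> [x [y z]].
- by move=> [[x y] z].
Qed.

Lemma iso_sum0 M : mod_iso ('rV[R]_0 * M)%type M.
Proof.
pose h (x : ('rV[R]_0 * M)%type) : M := x.2.
have hl : linear h by [].
exists (mk_linear hl), (fun x => (0, x)) => //.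
by move=> [x y]; rewrite mk_linearE /h [x]thinmx0.
Qed.

Lemma fp_fg M : fin_presented M -> fin_generated M.
Proof. by move=> [m [n [g [f [fs _]]]]]; exists n, f. Qed.

Lemma fp_iso M N : mod_iso M N -> fin_presented M -> fin_presented N.
Proof.
move=> [h [h' hK h'K]] [m [n [g [f [fs fk]]]]].
exists m, n, g, (h \o f); split.
  by move=> y; have [x xE] := fs (h' y); exists x; rewrite /= xE h'K.
move=> x; rewrite -fk /=; split; last by move=> ->; rewrite linear0.
by move=> e; apply: (can_inj hK); rewrite e linear0.
Qed.

Lemma fg_iso M N : mod_iso M N -> fin_generated M -> fin_generated N.
Proof.
move=> [h [h' hK h'K]] [n [f fs]]; exists n, (h \o f).
by move=> y; have [x xE] := fs (h' y); exists x; rewrite /= xE h'K.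
Qed.

Lemma fp_zero : fin_presented 'rV[R]_0.
Proof.
exists 0%N, 0%N, idfun, idfun; split; first by move=> y; exists y.
by move=> x; split=> [_|_]; [exists x | rewrite [LHS]thinmx0].
Qed.

Lemma fg_zero : fin_generated 'rV[R]_0.
Proof. by exists 0%N, idfun => y; exists y. Qed.

Section Pair.
Variables (n1 n2 : nat) (M1 M2 : lmodType R).
Variables (f1 : {linear 'rV[R]_n1 -> M1}) (f2 : {linear 'rV[R]_n2 -> M2}).
Definition row_pair (x : 'rV[R]_(n1 + n2)) : (M1 * M2)%type :=
  (f1 (lsubmx x), f2 (rsubmx x)).
Lemma row_pair_linear : linear row_pair.
Proof. by move=> a x y; rewrite /row_pair !linearP. Qed.
Lemma row_pair_surj : surj_lin f1 -> surj_lin f2 ->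
  surj_lin (mk_linear row_pair_linear).
Proof.
move=> s1 s2 [y1 y2]; have [x1 <-] := s1 y1; have [x2 <-] := s2 y2.
by exists (row_mx x1 x2); rewrite mk_linearE /row_pair row_mxKl row_mxKr.
Qed.
End Pair.

Lemma fg_sum M N : fin_generated M -> fin_generated N -> fin_generated (M * N)%type.
Proof.
move=> [n1 [f1 s1]] [n2 [f2 s2]].
by exists (n1 + n2)%N, (mk_linear (row_pair_linear f1 f2)); exact: row_pair_surj.
Qed.

Lemma fp_sum M N : fin_presented M -> fin_presented N -> fin_presented (M * N)%type.
Proof.
move=> [m1 [n1 [g1 [f1 [s1 k1]]]]] [m2 [n2 [g2 [f2 [s2 k2]]]]].
pose g (y : 'rV[R]_(m1 + m2)) : 'rV[R]_(n1 + n2) :=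
  row_mx (g1 (lsubmx y)) (g2 (rsubmx y)).
have gl : linear g.
  by move=> a x y; rewrite /g !linearP /= scale_row_mx add_row_mx.
exists (m1 + m2)%N, (n1 + n2)%N, (mk_linear gl), (mk_linear (row_pair_linear f1 f2)).
split; first exact: row_pair_surj.
move=> x; rewrite mk_linearE /row_pair; split.
  move=> [/k1[y1 e1] /k2[y2 e2]]; exists (row_mx y1 y2).
  by rewrite mk_linearE /g row_mxKl row_mxKr e1 e2 hsubmxK.
move=> [y <-]; rewrite mk_linearE /g row_mxKl row_mxKr.
by congr pair; [apply/k1; exists (lsubmx y) | apply/k2; exists (rsubmx y)].
Qed.

Lemma fg_summand M N : fin_generated (M * N)%type -> fin_generated M.
Proof.
move=> [n [f fs]]; pose h (x : (M * N)%type) : M := x.1.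
have hl : linear h by [].
exists n, (mk_linear hl \o f) => y; have [x xE] := fs (y, 0).
by exists x; rewrite /= mk_linearE /h xE.
Qed.

Lemma fp_summand M N : fin_presented (M * N)%type -> fin_presented M.
Proof.
move=> [m [n [g [f [fs fk]]]]].
have /choice[t tE] (i : 'I_n) : exists x, f x = (0, (f (delta_mx 0 i)).2) by exact: fs.
pose T : 'M[R]_n := \matrix_i t i.
have fT v : f (v *m T) = (0, (f v).2).
  rewrite mulmx_sum_row [in RHS](row_sum_delta v) !linear_sum /=.
  transitivity (\sum_i v 0 i *: ((0, (f (delta_mx 0 i)).2) : (M * N)%type)).
    by apply: eq_bigr => i _; rewrite linearZ /= rowK tE.
  apply: pair_ext.
    rewrite (big_morph (@fst M N) (fun _ _ => erefl) erefl) big1// => i _.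
    by rewrite /= scaler0.
  rewrite !(big_morph (@snd M N) (fun _ _ => erefl) erefl).
  by apply: eq_bigr => i _; rewrite [f (_ *: _)]linearZ.
pose h (x : (M * N)%type) : M := x.1.
have hl : linear h by [].
pose k (y : 'rV[R]_(m + n)) : 'rV[R]_n := g (lsubmx y) + rsubmx y *m T.
have kl : linear k.
  by move=> a x y; rewrite /k !linearP /= mulmxDl -scalemxAl scalerDr addrACA.
exists (m + n)%N, n, (mk_linear kl), (mk_linear hl \o f); split.
  by move=> y; have [x xE] := fs (y, 0); exists x; rewrite /= mk_linearE /h xE.
move=> x; rewrite /= mk_linearE /h; split.
  move=> fx; have /fk[y yE] : f (x - x *m T) = 0.
    by rewrite linearB fT; case: (f x) fx => _ b /= ->; rewrite subrr.
  by exists (row_mx y x); rewrite mk_linearE /k row_mxKl row_mxKr yE subrK.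
move=> [y <-]; rewrite mk_linearE /k linearD fT /=.
by have -> : f (g (lsubmx y)) = 0; [apply/fk; exists (lsubmx y) | rewrite addr0].
Qed.

Definition fp_class := ModClass fp_fg fp_iso fp_zero fp_sum fp_summand.

Definition fp_torsion M := fin_presented M /\ torsion M.

Lemma fpt_fg M : fp_torsion M -> fin_generated M.
Proof. by case=> /fp_fg. Qed.

Lemma fpt_iso M N : mod_iso M N -> fp_torsion M -> fp_torsion N.
Proof.
move=> iMN [fM tM]; split; first exact: fp_iso iMN fM.
case: iMN => h [h' hK h'K] y; have [r r0 rE] := tM (h' y); exists r => //.
by rewrite -[y]h'K -linearZ rE linear0.
Qed.

Lemma fpt_zero : fp_torsion 'rV[R]_0.
Proof.
split; first exact: fp_zero.
by move=> x; exists 1; [exact: oner_neq0 | rewrite [LHS]thinmx0].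
Qed.

Lemma fpt_sum M N : fp_torsion M -> fp_torsion N -> fp_torsion (M * N)%type.
Proof.
move=> [fM tM] [fN tN]; split; first exact: fp_sum.
move=> [x y]; have [r r0 rE] := tM x; have [s s0 sE] := tN y.
exists (r * s); first by rewrite mulf_neq0.
apply: pair_ext => /=; last by rewrite -scalerA sE scaler0.
by rewrite mulrC -scalerA rE scaler0.
Qed.

Lemma fpt_summand M N : fp_torsion (M * N)%type -> fp_torsion M.
Proof.
move=> [f t]; split; first exact: fp_summand f.
by move=> x; have [r r0 rE] := t (x, 0); exists r; last case: rE.
Qed.

Definition tor_class := ModClass fpt_fg fpt_iso fpt_zero fpt_sum fpt_summand.

Definition fg_projective M := fin_generated M /\ projective M.

Lemma fgp_fg M : fg_projective M -> fin_generated M.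
Proof. by case. Qed.

Lemma fgp_iso M N : mod_iso M N -> fg_projective M -> fg_projective N.
Proof.
move=> iMN [fM pM]; split; first exact: fg_iso iMN fM.
move=> A B p f ps; have [h' [h h'K hK]] := iso_sym iMN.
have [h1 [h1' h1K h1'K]] := iMN.
have [k kE] := pM A B p (f \o h1) ps.
have [h2 [h2' h2K h2'K]] := iso_sym iMN.
have hl : linear h1' by move=> a x y; apply: (can_inj h1K); rewrite h1'K linearP !h1'K.
by exists (k \o mk_linear hl) => x; rewrite /= kE /= mk_linearE h1'K.
Qed.

Lemma fgp_zero : fg_projective 'rV[R]_0.
Proof.
split; first exact: fg_zero.
move=> A B p f ps; exists \0 => x.
by rewrite [x]thinmx0 !linear0.
Qed.

Lemma fgp_sum M N : fg_projective M -> fg_projective N -> fg_projective (M * N)%type.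
Proof.
move=> [fM pM] [fN pN]; split; first exact: fg_sum.
move=> A B p f ps.
pose i (x : M) : (M * N)%type := (x, 0); pose j (x : N) : (M * N)%type := (0, x).
have il : linear i.
  by move=> a x y; apply: pair_ext; rewrite //= scaler0 addr0.
have jl : linear j.
  by move=> a x y; apply: pair_ext; rewrite //= scaler0 addr0.
have [k kE] := pM A B p (f \o mk_linear il) ps.
have [l lE] := pN A B p (f \o mk_linear jl) ps.
pose h (x : (M * N)%type) : A := k x.1 + l x.2.
have hl : linear h.
  by move=> a x y; rewrite /h /= !linearP scalerDr addrACA.
exists (mk_linear hl) => -[x y]; rewrite mk_linearE /h linearD kE lE /= -linearD.
by congr (f _); apply: pair_ext; rewrite /= ?addr0 ?add0r.
Qed.

Lemma fgp_summand M N : fg_projective (M * N)%type -> fg_projective M.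
Proof.
move=> [fMN pMN]; split; first exact: fg_summand fMN.
move=> A B p f ps; pose h (x : (M * N)%type) : M := x.1.
have hl : linear h by [].
have [k kE] := pMN A B p (f \o mk_linear hl) ps.
pose i (x : M) : (M * N)%type := (x, 0).
have il : linear i.
  by move=> a x y; apply: pair_ext; rewrite //= scaler0 addr0.
by exists (k \o mk_linear il) => x; rewrite /= kE.
Qed.

Definition proj_class := ModClass fgp_fg fgp_iso fgp_zero fgp_sum fgp_summand.

Lemma tor_fp M : tor_class M -> fp_class M.
Proof. by case. Qed.

Lemma proj_fp M : proj_class M -> fp_class M.
Proof.
move=> [[n [f fs]] pM]; have [s sE] := pM _ _ f idfun fs.
pose g (x : 'rV[R]_n) : 'rV[R]_n := x - s (f x).
have gl : linear g.
  by move=> a x y; rewrite /g !linearP scalerDr addrACA.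
exists n, n, (mk_linear gl), f; split=> // x; split.
  by move=> fx; exists x; rewrite mk_linearE /g fx linear0 subr0.
by move=> [y <-]; rewrite mk_linearE /g linearB sE subrr.
Qed.

End Modules.

Arguments fp_class R : clear implicits.
Arguments tor_class R : clear implicits.
Arguments proj_class R : clear implicits.

(** * The monoid of isomorphism classes *)

(* [lmodType R] lies in too large a universe for a quotient of it to be an
   [nmodType], so the class [M] of a finitely generated module M is encoded by
   the pairs (n, K), with K a submodule of R^n, such that R^n / K is isomorphic
   to M. By [V_classP], [V_ind] and [V_classD] below, [Vmon C] is the set of
   isomorphism classes of modules in C, with addition induced by the direct
   sum. *)

Section Codes.
Variable R : idomainType.
Implicit Types M N : lmodType R.

Definition code := {n : nat & set 'rV[R]_n}.

Definition iso_class M : set code :=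
  [set c | exists f : {linear 'rV[R]_(tag c) -> M},
    surj_lin f /\ tagged c = [set x | f x = 0]].

Lemma iso_of_ker (L : lmodType R) M N (f : {linear L -> M}) (g : {linear L -> N}) :
  surj_lin f -> surj_lin g -> (forall x, f x = 0 <-> g x = 0) -> mod_iso M N.
Proof.
move=> fs gs fg.
have eqfg x y : f x = f y <-> g x = g y.
  split=> e; apply/eqP; rewrite -subr_eq0 -linearB; apply/eqP/fg;
    by rewrite linearB e subrr.
have /choice[s sE] := fs; have /choice[t tE] := gs.
have hl : linear (g \o s).
  by move=> a x y /=; rewrite -linearP; apply/eqfg; rewrite linearP !sE.
exists (mk_linear hl), (f \o t).
- by move=> x; rewrite mk_linearE /= -[RHS]sE; apply/eqfg; rewrite tE.
- by move=> y; rewrite mk_linearE /= -[RHS]tE; apply/eqfg; rewrite sE.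
Qed.

Lemma iso_classP M N : fin_generated M ->
  iso_class M = iso_class N <-> mod_iso M N.
Proof.
have sub M' N' : mod_iso M' N' -> iso_class M' `<=` iso_class N'.
  move=> [h [h' hK h'K]] c [f [fs fk]]; exists (h \o f); split.
    by move=> y; have [x xE] := fs (h' y); exists x; rewrite /= xE h'K.
  rewrite fk; apply/seteqP; split=> x /=; first by move=> ->; rewrite linear0.
  by move=> e; apply: (can_inj hK); rewrite e linear0.
move=> [n [f fs]]; split=> [e|iMN].
  pose c : code := Tagged (fun n => set 'rV[R]_n) [set x | f x = 0].
  have [g [gs gk]] : iso_class N c by rewrite -e; exists f.
  apply: (iso_of_ker fs gs) => x.
  have : tagged c x = (g x = 0) by rewrite gk.
  by move=> <-.
by apply/seteqP; split; apply: sub => //; exact: iso_sym.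
Qed.

End Codes.

Section IsoClasses.
Variables (R : idomainType) (C : modClass R).

Definition Vmon := {X : set (code R) | exists2 M, C M & X = iso_class M}.

HB.instance Definition _ := gen_eqMixin Vmon.
HB.instance Definition _ := gen_choiceMixin Vmon.

Definition V_class (M : lmodType R) (CM : C M) : Vmon :=
  exist _ (iso_class M) (ex_intro2 _ _ M CM erefl).

Lemma V_eq (x y : Vmon) : sval x = sval y -> x = y.
Proof. by case: x y => [X p] [Y q] /= e; subst Y; rewrite (Prop_irrelevance p q). Qed.

Lemma V_classP M N (CM : C M) (CN : C N) :
  V_class CM = V_class CN <-> mod_iso M N.
Proof.
rewrite -(iso_classP N (class_fg CM)).
by split; [move=> /(congr1 sval) | move=> e; apply: V_eq].
Qed.

Lemma V_ind (T : Vmon -> Prop) :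
  (forall M (CM : C M), T (V_class CM)) -> forall x, T x.
Proof. by move=> h [X [M CM XE]]; subst X; exact: (h M CM). Qed.

Definition V_zero : Vmon := V_class (class_zero C).

Definition add_classes (X Y : set (code R)) : set (code R) :=
  [set c | exists M N, [/\ C M, C N, X = iso_class M, Y = iso_class N &
    iso_class (M * N)%type c]].

Lemma add_classesE M N : C M -> C N ->
  add_classes (iso_class M) (iso_class N) = iso_class (M * N)%type.
Proof.
move=> CM CN; apply/seteqP; split=> c; last by exists M, N.
move=> [M' [N' [CM' CN' /esym eM /esym eN]]].
have iM : mod_iso M' M by apply/iso_classP => //; exact: class_fg CM'.
have iN : mod_iso N' N by apply/iso_classP => //; exact: class_fg CN'.
suff -> : iso_class (M' * N')%type = iso_class (M * N)%type by [].
by apply/iso_classP; [exact/fg_sum/class_fg/CN'/class_fg/CM' | exact: iso_sum].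
Qed.

Lemma add_classes_proof (x y : Vmon) :
  exists2 M, C M & add_classes (sval x) (sval y) = iso_class M.
Proof.
elim/V_ind: x => M CM; elim/V_ind: y => N CN.
by exists (M * N)%type; [exact: class_sum | exact: add_classesE].
Qed.

Definition V_add (x y : Vmon) : Vmon := exist _ _ (add_classes_proof x y).

Lemma V_addE M N (CM : C M) (CN : C N) :
  V_add (V_class CM) (V_class CN) = V_class (class_sum CM CN).
Proof. by apply: V_eq; exact: add_classesE. Qed.

Lemma V_addA : associative V_add.
Proof.
elim/V_ind=> M CM; elim/V_ind=> N CN; elim/V_ind=> P CP; rewrite !V_addE.
by apply/V_classP; exact: iso_sumA.
Qed.

Lemma V_addC : commutative V_add.
Proof.
by elim/V_ind=> M CM; elim/V_ind=> N CN; rewrite !V_addE; apply/V_classP/iso_sumC.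
Qed.

Lemma V_add0 : left_id V_zero V_add.
Proof. by elim/V_ind=> M CM; rewrite V_addE; apply/V_classP; exact: iso_sum0. Qed.

HB.instance Definition _ := GRing.isNmodule.Build Vmon V_addA V_addC V_add0.

Lemma V_classD M N (CM : C M) (CN : C N) :
  V_class CM + V_class CN = V_class (class_sum CM CN).
Proof. exact: V_addE. Qed.

End IsoClasses.

Section Inclusion.
Variables (R : idomainType) (C D : modClass R) (CD : forall M, C M -> D M).

Lemma V_incl_proof (x : Vmon C) : exists2 M, D M & sval x = iso_class M.
Proof. by have [M CM xE] := svalP x; exists M; first exact: CD. Qed.

Definition V_incl_fun (x : Vmon C) : Vmon D := exist _ (sval x) (V_incl_proof x).

Lemma V_incl_additive : nmod_morphism V_incl_fun.
Proof.
split; first exact: V_eq.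
elim/V_ind=> M CM; elim/V_ind=> N CN; apply: V_eq.
rewrite V_classD /=; apply/esym; exact: add_classesE (CD CM) (CD CN).
Qed.

HB.instance Definition _ :=
  GRing.isNmodMorphism.Build (Vmon C) (Vmon D) V_incl_fun V_incl_additive.

Definition V_incl : {additive Vmon C -> Vmon D} := V_incl_fun.

Lemma V_inclE M (CM : C M) : V_incl (V_class CM) = V_class (CD CM).
Proof. exact: V_eq. Qed.

End Inclusion.

(* Main.v *)
(** Finitely generated ideals of a Prüfer domain are projective, so a finitely
    generated submodule of R^n is a direct sum of ideals.  The torsion
    submodule of a finitely presented M is the kernel of a map from M to some
    R^n (a cokernel matrix over the fraction field, with denominators cleared),
    hence it splits off.

    With the 1 1/2 generator property, I + J is isomorphic to R + L for ideals
    I, J of rank one, and determinants show that I is determined by R^n + I.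
    Hence V(C_proj) consists of 0 and Pic(R) x N_{>0} inside Pic(R) x N.

    If R is h-local and a <> 0 kills the torsion module T, orthogonal
    idempotents modulo a split T into modules killed by ideals I for which R/I
    is local.  Modulo such an I any two elements of R are comparable for
    divisibility, so a presentation matrix can be diagonalized and the pieces
    are direct sums of cyclic modules with local endomorphism rings.  The
    Krull-Schmidt exchange argument makes V(C_tor) free.

    An atom of V(C) is either prime or of rank one, and for atoms u, g, h of
    rank one there is an atom k of rank one with g + h = u + k.  These moves
    preserve lengths and have distance at most 2, and they connect any two
    factorizations of an element. *)

Require Import Defs.
From HB Require Import structures.
From mathcomp Require Import all_boot all_algebra finmap multiset.
From mathcomp Require Import boolp classical_sets cardinality.

Set Implicit Arguments.
Unset Strict Implicit.
Unset Printing Implicit Defensive.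

Import GRing.Theory.

(** * Submodules, kernels and images *)

Section Submodules.
Local Open Scope ring_scope.
Local Open Scope classical_set_scope.
Variable R : idomainType.

(** Rank one modules are kept as modules [N] with an injective map [psi] to R^1, and inverses of
    ideals are multiplied by a common denominator [d]: an element l of d (psi N)^-1 gives the linear
    form l psi / d on [N]. So R splits off I + J as soon as linear forms on I and on J have values
    with sum 1, and this is what the generator property supplies. Cancellation of R^n needs no
    exterior powers: an isomorphism has a determinant over the fraction field, and multiplication by
    it carries I onto J. The constant 2 arises as follows. All factorizations of an element have the
    same length, so two of them at distance at most 1 differ in at most one atom and are equal by
    cancellation; trading two atoms for two is the smallest possible move. It is available for all
    u, g, h because k = g h u^-1 exists in Pic(R). Whether there are two different rank one classes,
    that is, whether Pic(R) is nontrivial, separates the two alternatives. *)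

Definition submodule (M : lmodType R) (S : set M) :=
  S 0 /\ forall a x y, S x -> S y -> S (a *: x + y).

Section Subtype.
Variables (M : lmodType R) (S : set M) (hS : submodule S).

(* Depends on [hS] so that the closure instances below are keyed on it. *)
Definition submod_pred_of of submodule S : {pred M} := fun x => `[<S x>].
Local Notation submod_pred := (submod_pred_of hS).

Lemma submod_predP : GRing.submod_closed submod_pred.
Proof.
split; first by apply/asboolP; case: hS.
by move=> a x y /asboolP Sx /asboolP Sy; apply/asboolP; case: hS => _; apply.
Qed.

HB.instance Definition _ := GRing.isSubmodClosed.Build R M submod_pred
  (GRing.submod_closed_semi submod_predP).

Record submod := Submod { submod_val :> M; _ : submod_val \in submod_pred }.

HB.instance Definition _ := [isSub for submod_val].
HB.instance Definition _ := [Choice of submod by <:].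
HB.instance Definition _ := [SubChoice_isSubLmodule of submod by <:].

End Subtype.
End Submodules.

Arguments submod {R M S}.

Section ModuleLemmas.
Local Open Scope ring_scope.
Local Open Scope classical_set_scope.
Variable R : idomainType.
Implicit Types M N A B X Y : lmodType R.

Definition sub_val M (S : set M) (hS : submodule S) : {linear submod hS -> M} :=
  \val.

Lemma sub_val_inj M (S : set M) (hS : submodule S) : injective (sub_val hS).
Proof. exact: val_inj. Qed.

Lemma sub_valP M (S : set M) (hS : submodule S) x : S (sub_val hS x).
Proof. exact/asboolP/(valP x). Qed.

Lemma sub_val_ex M (S : set M) (hS : submodule S) y :
  S y -> exists x, sub_val hS x = y.
Proof. by move=> /asboolP Sy; exists (Submod Sy). Qed.

Lemma lin_factor M N A (i : {linear A -> M}) (f : {linear N -> M}) :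
  injective i -> (forall x, exists a, i a = f x) ->
  exists g : {linear N -> A}, forall x, i (g x) = f x.
Proof.
move=> i_inj /choice[g gE]; suff gl : linear g by exists (mk_linear gl).
by move=> a x y; apply: i_inj; rewrite linearP !gE linearP.
Qed.

Lemma inj_surj_iso M N (f : {linear M -> N}) :
  injective f -> surj_lin f -> mod_iso M N.
Proof.
move=> f_inj /choice[g gE]; exists f, g => x //.
by apply: f_inj; rewrite gE.
Qed.

Lemma lin_injP M N (f : {linear M -> N}) :
  (forall x, f x = 0 -> x = 0) -> injective f.
Proof.
move=> f0 x y e; apply/eqP; rewrite -subr_eq0; apply/eqP/f0.
by rewrite linearB e subrr.
Qed.

Lemma lin_inj0 M N (f : {linear M -> N}) x : injective f -> f x = 0 -> x = 0.
Proof. by move=> f_inj e; apply: f_inj; rewrite e linear0. Qed.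

Lemma ker_submodule M N (f : {linear M -> N}) : submodule [set x | f x = 0].
Proof.
split => [|a x y /= fx fy] /=; first exact: linear0.
by rewrite linearP fx fy scaler0 addr0.
Qed.

Lemma range_submodule M N (f : {linear M -> N}) : submodule (range f).
Proof.
split; first by exists 0 => //; exact: linear0.
by move=> a _ _ [x _ <-] [y _ <-]; exists (a *: x + y); rewrite // linearP.
Qed.

Definition lker M N (f : {linear M -> N}) : lmodType R := submod (ker_submodule f).
Definition ker_val M N (f : {linear M -> N}) : {linear lker f -> M} :=
  sub_val (ker_submodule f).

Arguments ker_val : simpl never.

Lemma ker_valP M N (f : {linear M -> N}) x : f (ker_val f x) = 0.
Proof. exact: (@sub_valP _ _ (ker_submodule f)). Qed.

Lemma ker_val_ex M N (f : {linear M -> N}) x :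
  f x = 0 -> exists y, ker_val f y = x.
Proof. exact: (@sub_val_ex _ _ (ker_submodule f)). Qed.

Lemma ker_val_inj M N (f : {linear M -> N}) : injective (ker_val f).
Proof. exact: sub_val_inj. Qed.

Definition limg M N (f : {linear M -> N}) : lmodType R :=
  submod (range_submodule f).
Definition img_val M N (f : {linear M -> N}) : {linear limg f -> N} :=
  sub_val (range_submodule f).

Arguments img_val : simpl never.

Lemma img_val_inj M N (f : {linear M -> N}) : injective (img_val f).
Proof. exact: sub_val_inj. Qed.

Lemma img_proj M N (f : {linear M -> N}) :
  exists p : {linear M -> limg f}, surj_lin p /\ forall x, img_val f (p x) = f x.
Proof.
have [p pE] : exists p : {linear M -> limg f}, forall x, img_val f (p x) = f x.
  apply: (lin_factor (@img_val_inj _ _ f)).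
  by move=> x; apply: (@sub_val_ex _ _ (range_submodule f)); exists x.
exists p; split=> // y; have [x _ xE] := sub_valP y; exists x.
by apply: (@img_val_inj _ _ f); rewrite pE xE.
Qed.

Lemma limg_fg M N (f : {linear M -> N}) : fin_generated M -> fin_generated (limg f).
Proof.
move=> [n [g gs]]; have [p [ps _]] := img_proj f; exists n, (p \o g) => y.
by have [x <-] := ps y; have [z <-] := gs x; exists z.
Qed.

Lemma lin_pair_subproof M A B (f : {linear M -> A}) (g : {linear M -> B}) :
  linear (fun x => (f x, g x) : (A * B)%type).
Proof. by move=> a x y; rewrite !linearP. Qed.
Definition lin_pair M A B (f : {linear M -> A}) (g : {linear M -> B}) :
  {linear M -> (A * B)%type} := mk_linear (lin_pair_subproof f g).

Lemma lin_copair_subproof M A B (f : {linear A -> M}) (g : {linear B -> M}) :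
  linear (fun x : (A * B)%type => f x.1 + g x.2).
Proof. by move=> a x y /=; rewrite !linearP scalerDr addrACA. Qed.
Definition lin_copair M A B (f : {linear A -> M}) (g : {linear B -> M}) :
  {linear (A * B)%type -> M} := mk_linear (lin_copair_subproof f g).

Lemma lin_inl_subproof A B : linear (fun x : A => (x, 0) : (A * B)%type).
Proof. by move=> a x y; apply: pair_ext; rewrite //= scaler0 addr0. Qed.
Definition lin_inl A B : {linear A -> (A * B)%type} :=
  mk_linear (@lin_inl_subproof A B).
Lemma lin_inr_subproof A B : linear (fun x : B => (0, x) : (A * B)%type).
Proof. by move=> a x y; apply: pair_ext; rewrite //= scaler0 addr0. Qed.
Definition lin_inr A B : {linear B -> (A * B)%type} :=
  mk_linear (@lin_inr_subproof A B).
Lemma lin_fst_subproof A B : linear (fun x : (A * B)%type => x.1).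
Proof. by []. Qed.
Definition lin_fst A B : {linear (A * B)%type -> A} :=
  mk_linear (@lin_fst_subproof A B).
Lemma lin_snd_subproof A B : linear (fun x : (A * B)%type => x.2).
Proof. by []. Qed.
Definition lin_snd A B : {linear (A * B)%type -> B} :=
  mk_linear (@lin_snd_subproof A B).

Lemma pair_split A B (x : (A * B)%type) :
  x = lin_inl A B x.1 + lin_inr A B x.2.
Proof. by apply: pair_ext; rewrite /= ?addr0 ?add0r. Qed.

(** The clause on the first component lets [iso_exchange] recognize its pivot after a change of
    coordinates. *)
Lemma split_bij M N (p : {linear M -> N}) (s : {linear N -> M}) :
  (forall y, p (s y) = y) ->
  exists2 h : {linear M -> (N * lker p)%type}, bijective h & forall x, (h x).1 = p x.
Proof.
move=> ps.
have sub_sp : linear (fun x => x - s (p x)).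
  by move=> a x y; rewrite !linearP scalerDr addrACA.
have [r rE] : exists r : {linear M -> lker p}, forall x, ker_val p (r x) = x - s (p x).
  have [||r rE] := @lin_factor _ _ _ (ker_val p) (mk_linear sub_sp); last by exists r.
    exact: ker_val_inj.
  by move=> x; apply: ker_val_ex; rewrite mk_linearE linearB ps subrr.
exists (lin_pair p r) => //; pose k := lin_copair s (ker_val p).
have pk y : p (k y) = y.1 by rewrite mk_linearE linearD ps ker_valP addr0.
exists k => [x|[y z]].
  have -> : k (lin_pair p r x) = s (p x) + ker_val p (r x) by [].
  by rewrite rE addrC subrK.
apply: pair_ext; first exact: pk.
apply: (@ker_val_inj _ _ p). rewrite [LHS]rE pk.
have -> : k (y, z) = s y + ker_val p z by [].
by rewrite addrAC subrr add0r.
Qed.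

Lemma split_iso M N (p : {linear M -> N}) (s : {linear N -> M}) :
  (forall y, p (s y) = y) -> mod_iso (N * lker p)%type M.
Proof. by move=> /split_bij[h bh _]; apply: iso_sym; exists h. Qed.

Lemma projective_split (P M : lmodType R) (p : {linear M -> P}) : projective P -> surj_lin p ->
  mod_iso (P * lker p)%type M.
Proof. by move=> pP ps; have [s sE] := pP _ _ p idfun ps; exact: (split_iso sE). Qed.

Lemma free_projective n : fg_projective 'rV[R]_n.
Proof.
split; first by exists n, idfun => y; exists y.
move=> M N p f ps.
have /choice[m mE] (i : 'I_n) : exists x, p x = f (delta_mx 0 i) by exact: ps.
have gl : linear (fun v : 'rV[R]_n => \sum_i v 0 i *: m i).
  move=> a x y; rewrite scaler_sumr -big_split; apply: eq_bigr => i _ /=.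
  by rewrite !mxE scalerDl scalerA.
exists (mk_linear gl) => x; rewrite mk_linearE linear_sum [in RHS](row_sum_delta x).
rewrite linear_sum; apply: eq_bigr => i _.
by rewrite [LHS]linearZ [RHS]linearZ mE.
Qed.

(* Gaussian elimination with the component [A -> B] of [f] as pivot. *)
Lemma iso_cancel A X B Y (f : {linear (A * X)%type -> (B * Y)%type}) g :
  cancel f g -> cancel g f ->
  bijective (fun a => (f (lin_inl A X a)).1) -> mod_iso X Y.
Proof.
move=> fK gK [h hK Kh]; apply: iso_sym.
have gl : linear g.
  by move=> a x y; apply: (can_inj fK); rewrite gK linearP !gK.
apply: (@inj_surj_iso _ _ (lin_snd A X \o mk_linear gl \o lin_inr B Y)).
  apply: lin_injP => y /=; rewrite !mk_linearE.
  case E: (g (0, y)) => [a x] /= x0; rewrite x0 in E.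
  have : f (lin_inl A X a) = (0, y) by rewrite -[RHS]gK E.
  move=> e; have a0 : a = 0.
    by rewrite -[a]hK e -[RHS]hK /= linear0.
  by move: e; rewrite a0 !linear0 => -[].
move=> x.
(* Chosen so that the [B]-component of f (a, x) vanishes; then [g] maps (0, (f (a, x)).2) back to
   (a, x). *)
pose a := h (- (f (lin_inr A X x)).1).
have aE : (f (lin_inl A X a)).1 = - (f (lin_inr A X x)).1 by exact: Kh.
exists (f (a, x)).2; rewrite /= !mk_linearE.
suff -> : (0, (f (a, x)).2) = f (a, x) by rewrite fK.
apply: pair_ext => //=.
by rewrite [(a, x)]pair_split linearD /= aE addNr.
Qed.

End ModuleLemmas.

(** * Modules with local endomorphism rings *)

Section LocalEndomorphisms.
Local Open Scope ring_scope.
Variable R : idomainType.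
Implicit Types A B M N X Y : lmodType R.

Definition loc_mod A := (exists x : A, x != 0) /\
  forall f g : {linear A -> A}, (forall x, f x + g x = x) ->
    bijective f \/ bijective g.

Lemma lin_inverse M N (f : {linear M -> N}) : bijective f ->
  exists g : {linear N -> M}, cancel f g /\ cancel g f.
Proof.
move=> [g fK gK].
have gl : linear g by move=> a x y; apply: (can_inj fK); rewrite gK linearP !gK.
by exists (mk_linear gl).
Qed.

(* The idempotent [q (p q)^-1 p] of the local module [B] is 0 or 1. *)
Lemma loc_mod_summand A B (q : {linear A -> B}) (p : {linear B -> A}) :
  (exists x : A, x != 0) -> loc_mod B -> bijective (p \o q) -> bijective q.
Proof.
move=> [x0 x0N] [_ lB] pq; have [u [uK Ku]] := lin_inverse pq.
pose e : {linear B -> B} := q \o u \o p.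
have ee y : e (e y) = e y by rewrite /e /=; congr (q _); rewrite [p (q _)]Ku.
have el : linear (fun y => y - e y).
  by move=> a x y; rewrite !linearP scalerDr addrACA.
have qI : injective q by move=> x y /(congr1 p) /(bij_inj pq).
have [|eb|eb] := lB e (mk_linear el).
- by move=> y; rewrite mk_linearE addrC subrK.
- exists (u \o p) => y /=; first by rewrite [u (p _)]uK.
  by apply: (bij_inj eb); rewrite -[RHS]ee.
- case/eqP: x0N; apply: qI; rewrite linear0; apply: (bij_inj eb).
  by rewrite [RHS]linear0 mk_linearE /e /= [u (p _)]uK subrr.
Qed.

(** The identity of [A] is the sum of its passages through [B] and through [Y], and since [A] is
    local one of them is bijective. If it is the passage through [B], locality of [B] makes [qB]
    bijective, a pivot to cancel. Otherwise [A] splits off [Y] with complement Z, and cancelling [A]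
    between A + X and A + (B + Z) leaves X = B + Z. *)
Lemma iso_exchange A X B Y : loc_mod A -> loc_mod B ->
  mod_iso (A * X)%type (B * Y)%type ->
  (mod_iso A B /\ mod_iso X Y) \/
  exists Z : lmodType R, mod_iso Y (A * Z)%type /\ mod_iso X (B * Z)%type.
Proof.
move=> [A0 lA] lB [f bf]; have [g [fK gK]] := lin_inverse bf.
pose qB := lin_fst B Y \o f \o lin_inl A X.
pose qY := lin_snd B Y \o f \o lin_inl A X.
pose pB := lin_fst A X \o g \o lin_inl B Y.
pose pY := lin_fst A X \o g \o lin_inr B Y.
have pq a : (pB \o qB) a + (pY \o qY) a = a.
  transitivity (g (f (lin_inl A X a))).1; last by rewrite fK.
  by rewrite [f (lin_inl A X a)]pair_split linearD.
have [pqB|pqY] := lA _ _ pq; [left | right].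
  have bq : bijective qB by exact: loc_mod_summand pqB.
  by split; [exists qB | exact: iso_cancel fK gK bq].
have [u [uK Ku]] := lin_inverse pqY.
have [|h bh hE] := @split_bij _ _ _ pY (qY \o u); first by move=> y; exact: Ku.
exists (lker pY); split; first by exists h.
have [k [hK kK]] := lin_inverse bh.
pose F0 := lin_pair (lin_fst _ _ \o h \o lin_snd B Y)
  (lin_pair (lin_fst B Y) (lin_snd _ _ \o h \o lin_snd B Y)).
pose G0 (x : (A * (B * lker pY))%type) : (B * Y)%type := (x.2.1, k (x.1, x.2.2)).
have F0K : cancel F0 G0.
  move=> [b y]; apply: pair_ext => //=; rewrite /G0 /= !mk_linearE /=.
  by rewrite -surjective_pairing hK.
have G0K : cancel G0 F0.
  by move=> [a [b z]]; rewrite /F0 /G0 /= !mk_linearE /= kK.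
apply: (@iso_cancel _ A X A _ (F0 \o f) (g \o G0)).
- by move=> x; rewrite /= F0K fK.
- by move=> x; rewrite /= gK G0K.
- apply: (eq_bij pqY) => a.
  by rewrite -[RHS]/((h (f (lin_inl A X a)).2).1) hE.
Qed.

End LocalEndomorphisms.

(** * Multisets and distances of factorizations *)

Section Multisets.
Local Open Scope mset_scope.
Variable G : nmodType.
Implicit Types z w : {mset G}.

Lemma perm_msetD z w : perm_eq (z `+` w)%mset (z ++ w).
Proof.
apply/eq_seq_msetP; rewrite seq_mset_id; apply/msetP => x.
by rewrite mset_seqE count_cat !count_mem_mset msetE2.
Qed.

Lemma size_msetD z w : size (z `+` w)%mset = (size z + size w)%N.
Proof. by rewrite (perm_size (perm_msetD z w)) size_cat. Qed.

Lemma sum_msetD z w :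
  (\sum_(u <- (z `+` w)%mset) u = \sum_(u <- z) u + \sum_(u <- w) u)%R.
Proof. by rewrite (perm_big _ (perm_msetD z w)) big_cat. Qed.

Lemma size_mset1 (u : G) : size [mset u] = 1%N.
Proof. by rewrite enum_msetn. Qed.

Lemma sum_mset1 (u : G) : (\sum_(v <- [mset u]) v = u)%R.
Proof. by rewrite enum_msetn big_seq1. Qed.

Lemma sum_mset0 : (\sum_(v <- (mset0 : {mset G})) v = 0)%R.
Proof. by rewrite enum_mset0 big_nil. Qed.

Lemma size_msubset z w : (z `<=` w)%mset -> (size z <= size w)%N.
Proof. by move=> /msetBDKC <-; rewrite size_msetD leq_addr. Qed.

Lemma mset_size1 z : size z = 1%N -> exists u, z = [mset u].
Proof.
case: (mset_0Vmem z) => [->|[u uz]]; first by rewrite size_mset0.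
rewrite -(msetB1K uz) size_msetD size_mset1 => -[/eqP].
by rewrite size_mset_eq0 => /eqP ->; exists u; rewrite msetD0.
Qed.

Lemma mset_mem_split u z : u \in z -> exists w, z = (u +` w)%mset.
Proof. by move=> /msetB1K <-; exists (z `\ u)%mset. Qed.

Lemma mset_size2 z : (1 < size z)%N -> exists u v w, z = (u +` (v +` w))%mset.
Proof.
case: (mset_0Vmem z) => [->|[u uz]]; first by rewrite size_mset0.
rewrite -(msetB1K uz) size_msetD size_mset1.
case: (mset_0Vmem (z `\ u)%mset) => [->|[v vz]]; first by rewrite size_mset0.
by move=> _; exists u, v, (z `\ u `\ v)%mset; rewrite (msetB1K vz).
Qed.

End Multisets.

Section Distance.
Local Open Scope mset_scope.
Variable H : nmodType.
Implicit Types z w : {mset reduced H}.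

Lemma fdistDl w z z' : fdist (w `+` z) (w `+` z') = fdist z z'.
Proof. by rewrite /fdist -msetDIr !msetBDl. Qed.

Lemma fdist_le z z' : (fdist z z' <= maxn (size z) (size z'))%N.
Proof.
by rewrite geq_max !leq_max !(size_msubset (msubsetDl _ _)) orbT.
Qed.

End Distance.

(** * Catenary and tame degrees of exchange monoids *)

Section ExtendedNaturals.
Local Open Scope classical_set_scope.
Implicit Types (A : set nat) (n : nat).

Lemma einf_le A n : A n -> enat_le (einf A) n.
Proof.
move=> An; rewrite /einf; case: pselect => [h|[]]; last by exists n.
by case: ex_minnP => m _ /= ->//; exact/asboolP.
Qed.

Lemma einf_leP A n : enat_le (einf A) n -> exists2 m, A m & (m <= n)%N.
Proof.
rewrite /einf; case: pselect => // h.
by case: ex_minnP => m /asboolP Am _ /= mn; exists m.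
Qed.

Lemma einf_eq A n : A n -> (forall m, A m -> (n <= m)%N) -> einf A = Some n.
Proof.
move=> An nmin; rewrite /einf; case: pselect => [h|[]]; last by exists n.
case: ex_minnP => m /asboolP Am mmin; congr Some; apply/eqP.
by rewrite eqn_leq nmin // mmin //; exact/asboolP.
Qed.

(** Catenary and tame degree are both suprema of infima: a uniform bound [n] and one element [t]
    where it is sharp determine them. *)
Lemma esup_einf_eq (T : Type) (D : set T) (F : T -> set nat) n t :
  (forall x, D x -> F x n) -> D t -> (forall m, F t m -> (n <= m)%N) ->
  esup [set einf (F x) | x in D] = Some n.
Proof.
move=> Fn Dt Ft; apply: einf_eq => [_ [x Dx <-]|m ub].
  exact/einf_le/Fn.
have /einf_leP[k Fk km] := ub _ (imageP (fun x => einf (F x)) Dt).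
exact: leq_trans (Ft _ Fk) km.
Qed.

End ExtendedNaturals.

(** * Factorizations when the atoms that are not prime can be exchanged *)

Section ExchangeMonoid.
Local Open Scope ring_scope.
Local Open Scope classical_set_scope.
Local Open Scope mset_scope.
Variable H : nmodType.
Local Notation G := (reduced H).
Variable E : set G.
Hypothesis canG : cancellative G.
Hypothesis conG : forall a b : G, a + b = 0 -> a = 0.
Hypothesis atmG : forall x : G, exists z, factorizations x z.
Hypothesis prime_or_E : forall u : G, matom u -> mprime u \/ E u.
Hypothesis atomE : forall u : G, E u -> matom u.
Hypothesis exchE : forall u g h : G, E u -> E g -> E h ->
  exists2 k, E k & g + h = u + k.
Implicit Types z w : {mset G}.

Local Notation msum z := (\sum_(t <- z) t).

Lemma munit_eq0 (a : G) : munit a -> a = 0.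
Proof. by move=> [b]; exact: conG. Qed.

Lemma matom_neq0 (a : G) : matom a -> a <> 0.
Proof. by move=> [ua _] a0; apply: ua; rewrite a0; exact: munit0. Qed.

Lemma matom_dvd (u v : G) : matom u -> matom v -> mdvd u v -> u = v.
Proof.
move=> au [_ av] [c vE]; have [/munit_eq0/(matom_neq0 au)//|/munit_eq0 c0] := av _ _ vE.
by rewrite vE c0 addr0.
Qed.

Lemma prime_dvd_sum (p : G) (s : seq G) : mprime p -> mdvd p (\sum_(t <- s) t) ->
  exists2 v, v \in s & mdvd p v.
Proof.
move=> [up pp]; elim: s => [|v s IH].
  by rewrite big_nil => -[c /esym pc]; case: up; exists c.
rewrite big_cons => /pp[|/IH[w ws pw]]; first by exists v; rewrite ?mem_head.
by exists w; rewrite // in_cons ws orbT.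
Qed.

Lemma prime_mem (p : G) x z : mprime p -> matom p -> factorizations x z ->
  mdvd p x -> p \in z.
Proof.
move=> pp pa [za <-] /(prime_dvd_sum pp)[v vz pv].
by rewrite (matom_dvd pa (za v vz) pv).
Qed.

Lemma mem_dvd_sum (u : G) z : u \in z -> mdvd u (msum z).
Proof. by move=> /msetB1K <-; rewrite sum_msetD sum_mset1; exists (msum (z `\ u)). Qed.

Lemma factD1 (u : G) x z : matom u ->
  factorizations (u + x) (u +` z) <-> factorizations x z.
Proof.
move=> ua; split=> -[za zs]; split.
- by move=> v vz; apply: za; rewrite in_mset1D vz orbT.
- by apply: (@canG u); rewrite -zs sum_msetD sum_mset1.
- by move=> v; rewrite in_mset1D => /orP[/eqP ->|/za].
- by rewrite sum_msetD sum_mset1 zs.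
Qed.

Lemma fact0 z : factorizations (0 : G) z -> z = mset0.
Proof.
case: (mset_0Vmem z) => // -[u uz] [za]; rewrite -(msetB1K uz) sum_msetD sum_mset1.
by move=> /conG u0; case: (matom_neq0 (za u uz)).
Qed.

Lemma fact_atom (u : G) z : matom u -> factorizations u z -> z = [mset u].
Proof.
move=> ua zu; have [za zs] := zu.
case: (mset_0Vmem z) => [z0|[v vz]].
  by case: (matom_neq0 ua); rewrite -zs z0 sum_mset0.
have vu : v = u.
  by apply: matom_dvd (za v vz) ua _; rewrite -zs; exact: mem_dvd_sum.
move: zu; rewrite vu in vz; rewrite -(msetB1K vz) -[X in factorizations X]addr0.
by rewrite factD1 // => /fact0 ->; rewrite msetD0.
Qed.

Definition chained x z z' := exists s : seq {mset G},
  [/\ forall y, y \in s -> factorizations x y,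
      path (fun y y' => (fdist y y' <= 2)%N) z s & last z s = z'].

Lemma chained_refl x z : chained x z z.
Proof. by exists [::]. Qed.

Lemma chained_cons (u : G) x z z' : matom u -> chained x z z' ->
  chained (u + x) (u +` z) (u +` z').
Proof.
move=> ua [s [sf sp sl]]; exists [seq u +` y | y <- s]; split.
- by move=> _ /mapP[y /sf yf ->]; exact/factD1.
- by rewrite path_map (eq_path (e' := fun y y' => (fdist y y' <= 2)%N)) // => y y' /=;
    rewrite fdistDl.
- by rewrite last_map sl.
Qed.

Lemma chained_rcons x z w z' : chained x z w -> factorizations x z' ->
  (fdist w z' <= 2)%N -> chained x z z'.
Proof.
move=> [s [sf sp sl]] fz' d; exists (rcons s z'); split.
- by move=> y; rewrite mem_rcons in_cons => /orP[/eqP ->|/sf].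
- by rewrite rcons_path sp sl.
- by rewrite last_rcons.
Qed.

(** A common atom of [z] and [z'] is cancelled. If there is none, no atom is prime, as a prime atom
    would occur in both; so all atoms are in [E]. Trading two atoms g, h of [z'] for an atom u of
    [z] and some k is one step of length at most 2 and creates a common atom. The three conclusions
    share this induction; for the last one, u = g contradicts disjointness. *)
Lemma fact_chain n x z z' : (size z + size z' <= n)%N ->
  factorizations x z -> factorizations x z' ->
  [/\ size z = size z', chained x z z' &
      (forall g h, E g -> E h -> g = h) -> z = z'].
Proof.
elim: n x z z' => [|n IH] x z z' szn fz fz'.
  move: szn; rewrite leqn0 addn_eq0 !size_mset_eq0 => /andP[/eqP -> /eqP ->].
  by split=> //; exact: chained_refl.
have shared u : u \in z -> u \in z' -> [/\ size z = size z', chained x z z' &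
      (forall g h, E g -> E h -> g = h) -> z = z'].
  move=> uz uz'; have ua : matom u by case: fz => + _; apply.
  have [z1 zE] := mset_mem_split uz; have [z1' z'E] := mset_mem_split uz'.
  have xE : x = u + msum z1 by case: fz => _ <-; rewrite zE sum_msetD sum_mset1.
  move: szn fz fz'; rewrite zE z'E xE !size_msetD !size_mset1 !factD1 // => szn fz fz'.
  have [|e1 e2 e3] := IH _ _ _ _ fz fz'.
    by move: szn; rewrite !add1n addSn ltnS addnS => /ltnW.
  split; [by rewrite e1 | exact: chained_cons | by move=> /e3 ->].
have inE z1 z2 : factorizations x z1 -> factorizations x z2 ->
    (forall u, u \in z1 -> u \in z2 -> False) -> forall u, u \in z1 -> E u.
  move=> f1 f2 dis u uz; have [a1 s1] := f1; have ua := a1 u uz.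
  case: (prime_or_E ua) => // up; case: (dis u uz).
  by apply: prime_mem f2 _ => //; rewrite -s1; exact: mem_dvd_sum.
have [[u [uz uz']]|dis] := pselect (exists u, u \in z /\ u \in z'); first exact: shared uz'.
have zE : forall u, u \in z -> E u.
  by apply: inE fz fz' _ => u uz uz'; apply: dis; exists u.
have z'E : forall u, u \in z' -> E u.
  by apply: inE fz' fz _ => u uz' uz; apply: dis; exists u.
case: (mset_0Vmem z') => [z'0|[v vz']].
  move: fz' fz; rewrite z'0 => -[_ <-]; rewrite sum_mset0 => /fact0 ->.
  by split=> //; exact: chained_refl.
case: (mset_0Vmem z) => [z0|[u uz]].
  by move: fz' vz'; case: fz => _ <-; rewrite z0 sum_mset0 => /fact0 ->; rewrite in_mset0.
(* With a single atom in [z'], x is that atom and [z] consists of it too, so the two are not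
   disjoint. *)
have [sz'|sz'] := leqP (size z') 1.
  have sz'1 : size z' = 1%N.
    by apply/eqP; rewrite eqn_leq sz' lt0n size_mset_eq0; apply: contraL vz' => /eqP ->;
       rewrite in_mset0.
  have [w wE] := mset_size1 sz'1; case: dis.
  have [a' s'] := fz'; have xw : x = w by rewrite -s' wE sum_mset1.
  have wz : z = [mset w].
    by apply: fact_atom; [apply: a'; rewrite wE mset11 | rewrite -xw].
  by exists w; rewrite wz wE mset11.
have [g [h [w z'E']]] := mset_size2 sz'.
have Eg : E g by apply: z'E; rewrite z'E' mset1D1.
have Eh : E h by apply: z'E; rewrite z'E' !in_mset1D eqxx orbT.
have Eu := zE u uz; have [k Ek ghE] := exchE Eu Eg Eh.
have xE : x = u + msum (z `\ u).
  by case: fz => _ <-; rewrite -{1}(msetB1K uz) sum_msetD sum_mset1.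
have fy : factorizations x (u +` (k +` w)).
  have [a' s'] := fz'; split.
    move=> t; rewrite !in_mset1D => /or3P[/eqP ->|/eqP ->|tw]; try exact: atomE.
    by apply: a'; rewrite z'E' !in_mset1D tw !orbT.
  by rewrite -s' z'E' !sum_msetD !sum_mset1 !addrA ghE.
have := fy; have := fz; rewrite -{1}(msetB1K uz) {1}xE factD1; last exact: atomE.
rewrite {1}xE factD1; last exact: atomE.
move=> fz1 fy1; have [|e1 e2 e3] := IH _ _ _ _ fz1 fy1.
  move: szn; rewrite z'E' -{1}(msetB1K uz) !size_msetD !size_mset1 !add1n addSn !addnS ltnS.
  exact: ltnW.
split.
- by rewrite -(msetB1K uz) z'E' !size_msetD !size_mset1 e1 !size_msetD size_mset1.
- apply: (@chained_rcons _ _ (u +` (k +` w))) => //.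
    by rewrite -(msetB1K uz) xE; apply: chained_cons e2; exact: atomE.
  rewrite z'E' !msetDA -!(msetDC w) fdistDl (leq_trans (fdist_le _ _)) //.
  by rewrite !size_msetD !size_mset1.
- move=> sub; case: dis; exists u; split=> //.
  by rewrite (sub u g) // z'E' mset1D1.
Qed.

(** A prime [u] occurs in every factorization of its multiples. For [u] in [E], a prime atom of [v]
    differs from [u] and can be removed without losing divisibility by [u]. What remains lies in [E]
    and has at least two atoms, and any two of them form the required subproduct g + h = u + k. *)
Lemma tame_le2 (u : G) : matom u -> tame_bound u 2%N.
Proof.
move=> ua x v ux vf uv; have [up|Eu] := prime_or_E ua.
  by case/negP: uv; exact: prime_mem vf ux.
have [n] := ubnP (size v); elim: n x v ux vf uv => // n IH x v ux vf uv szv.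
have [va vs] := vf.
have [[p [pv pp]]|np] := pselect (exists p, p \in v /\ mprime p).
  have pa := va p pv; have [c xE] := ux.
  have xE' : x = p + msum (v `\ p).
    by rewrite -vs -{1}(msetB1K pv) sum_msetD sum_mset1.
  have : mdvd p (u + c) by exists (msum (v `\ p)); rewrite -xE.
  case: pp => up pp /pp[pu|[d cE]].
    by move: uv; rewrite -(matom_dvd pa ua pu) pv.
  have uv' : u \notin v `\ p by apply: contra uv; rewrite in_msetB1 => /andP[].
  have [|||w [y [wv uw yf sz]]] := IH (msum (v `\ p)) (v `\ p) _ _ uv'.
  - by exists d; apply: (@canG p); rewrite -xE' xE cE addrCA.
  - by split=> // t; rewrite in_msetB1 => /andP[_ /va].
  - by move: szv; rewrite -{1}(msetB1K pv) size_msetD size_mset1 add1n ltnS.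
  by exists w, y; split=> //; exact: msubset_trans wv (msubD1set _ _).
have vE t : t \in v -> E t.
  by move=> tv; have [tp|//] := prime_or_E (va t tv); case: np; exists t.
have [sz1|sz2] := leqP (size v) 1.
  case: (mset_0Vmem v) => [v0|[t tv]].
    have [c] := ux; rewrite -vs v0 sum_mset0 => /esym/conG u0.
    by case: (matom_neq0 ua).
  have [|w wE] := @mset_size1 _ v.
    by apply/eqP; rewrite eqn_leq sz1 lt0n size_mset_eq0; apply: contraL tv => /eqP ->;
       rewrite in_mset0.
  case/negP: uv; rewrite wE in_mset1; apply/eqP/matom_dvd => //.
    by apply: va; rewrite wE mset11.
  by move: ux; rewrite -vs wE sum_mset1.
have [g [h [w vE']]] := mset_size2 sz2.
have Eg : E g by apply: vE; rewrite vE' mset1D1.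
have Eh : E h by apply: vE; rewrite vE' !in_mset1D eqxx orbT.
have [k Ek ghE] := exchE Eu Eg Eh.
exists (g +` [mset h]), [mset k]; rewrite !sum_msetD !sum_mset1 ghE; split.
- by rewrite vE' msetDA -[X in msubset X _]msetD0; exact/msetDS/msub0set.
- by exists k.
- split; last by rewrite sum_msetD !sum_mset1.
  by move=> t; rewrite in_mset1D in_mset1 => /orP[] /eqP ->; exact: atomE.
- by rewrite !size_msetD !size_mset1.
Qed.

Hypothesis canH : cancellative H.

Lemma exchange_half_factorial : half_factorial H.
Proof.
split=> // [a|a]; first exact: atmG.
have [z zf] := atmG (red a); exists (size z); split; first by exists z.
by move=> _ [z' z'f <-]; have [] := fact_chain (leqnn _) zf z'f.
Qed.

Lemma exchange_factorial : (forall g h, E g -> E h -> g = h) -> factorial_monoid H.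
Proof.
move=> sub; split=> // a; have [z zf] := atmG (red a); exists z; split=> // z' z'f.
by have [_ _] := fact_chain (leqnn _) zf z'f; apply.
Qed.

(** Both lower bounds come from the element e + e = g + k: its factorization into two copies of [e]
    is not linked to any other one by steps of length at most 1, and none of its subproducts with at
    most one factor is a multiple of [g]. *)
Lemma exchange_degrees (e g : G) : E e -> E g -> e <> g ->
  catenary_degree H = Some 2%N /\ tame_degree H = Some 2%N.
Proof.
move=> Ee Eg eg; have [k Ek eeE] := exchE Eg Ee Ee.
have fe : factorizations (e + e) (e +` [mset e]).
  split; last by rewrite sum_msetD !sum_mset1.
  by move=> t; rewrite in_mset1D in_mset1 => /orP[] /eqP ->; exact: atomE.
have fg : factorizations (e + e) (g +` [mset k]).
  split; last by rewrite sum_msetD !sum_mset1.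
  by move=> t; rewrite in_mset1D in_mset1 => /orP[] /eqP ->; exact: atomE.
have gNe : g \notin e +` [mset e].
  by rewrite in_mset1D in_mset1 orbb; apply/eqP => /esym.
split.
  have eeR : red (repr (e + e)) = e + e by rewrite /red reprK.
  apply: (@esup_einf_eq _ _ (@chain_bound H) 2%N (repr (e + e))) => // [a _ z z' zf z'f|m].
    by have [_] := fact_chain (leqnn _) zf z'f.
  rewrite /chain_bound /Zfact /= eeR => /(_ _ _ fe fg)[s [sf sp sl]].
  rewrite ltnNge; apply/negP => m1.
  (* By equal lengths the two factorizations differ by the same number of atoms, at most one;
     cancelling the common part in the sums identifies the remaining atoms. *)
  have stay : forall y, factorizations (e + e) y -> (fdist (e +` [mset e]) y <= m)%N ->
      y = e +` [mset e].
    move=> y yf d; have [szy _ _] := fact_chain (leqnn _) fe yf.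
    set z := e +` [mset e] in fe d szy *.
    have zE := esym (msetBDKC (msubsetIl z y)).
    have yE := esym (msetBDKC (msubsetIr z y)).
    have := leq_trans d m1; rewrite /fdist geq_max => /andP[d1 d2].
    have szE : size (z `\` (z `&` y)) = size (y `\` (z `&` y)).
      by apply/eqP; rewrite -(eqn_add2l (size (z `&` y))) -!size_msetD -zE -yE szy.
    have [z0|z0] := posnP (size (z `\` (z `&` y))).
      move: szE z0 => /esym; move=> + z0; rewrite z0 => /eqP; move/eqP: z0.
      by rewrite !size_mset_eq0 => /eqP z0 /eqP y0; rewrite yE [RHS]zE z0 y0.
    have s1 : size (z `\` (z `&` y)) = 1%N by apply/eqP; rewrite eqn_leq d1 z0.
    have [t tE] := mset_size1 s1; rewrite szE in s1; have [t' t'E] := mset_size1 s1.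
    rewrite yE [RHS]zE tE t'E; congr (_ `+` [mset _]).
    apply: (@canG (msum (z `&` y))).
    rewrite -[X in _ + X = _]sum_mset1 -[X in _ = _ + X]sum_mset1 -t'E -tE -!sum_msetD -zE -yE.
    by move: fe yf => [_ ->] [_ ->].
  have : forall s, (forall y, y \in s -> factorizations (e + e) y) ->
     path (fun y y' => (fdist y y' <= m)%N) (e +` [mset e]) s ->
     last (e +` [mset e]) s = e +` [mset e].
    elim=> [//|y s' IH] sf' /= /andP[d p].
    have yE := stay _ (sf' y (mem_head _ _)) d; rewrite yE; apply: IH.
      by move=> t ts; apply: sf'; rewrite in_cons ts orbT.
    by rewrite -{1}yE.
  move=> /(_ s sf sp); rewrite sl => gE; move: gNe.
  by rewrite -gE mset1D1.
apply: (@esup_einf_eq _ _ (@tame_bound H) 2%N g) => [u||m tm]; first exact: tame_le2.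
  exact: atomE.
have [|w [y [wv [c gw] _ sz]]] := tm _ _ _ fe gNe; first by exists k.
apply: leq_trans sz; rewrite leq_max; apply/orP; right; rewrite ltnNge.
apply/negP => w1; case: (mset_0Vmem w) => [w0|[t tw]].
  by move: gw; rewrite w0 sum_mset0 => /esym/conG g0; case: (matom_neq0 (atomE Eg)).
have wE : w = [mset e].
  have [|s sE] := @mset_size1 _ w.
    by apply/eqP; rewrite eqn_leq w1 lt0n size_mset_eq0; apply: contraL tw => /eqP ->;
       rewrite in_mset0.
  have : s \in e +` [mset e] by apply: (msubset_subset wv); rewrite sE mset11.
  by rewrite sE in_mset1D in_mset1 orbb => /eqP ->.
apply: eg; apply/esym/matom_dvd; try exact: atomE.
by exists c; rewrite -gw wE sum_mset1.
Qed.

End ExchangeMonoid.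

(** * Free monoids *)

Section FreeMonoid.
Local Open Scope ring_scope.
Local Open Scope classical_set_scope.
Variables (B : nmodType) (P : set B).
Hypothesis exchP : forall a b x y : B, P a -> P b -> a + x = b + y ->
  (a = b /\ x = y) \/ exists z, y = a + z /\ x = b + z.
Hypothesis genP : forall x : B, exists s : seq B,
  (forall p, p \in s -> P p) /\ x = \sum_(p <- s) p.
Hypothesis conP : forall a x : B, P a -> a + x <> 0.

(** If the heads [a] and [b] are not matched, the exchange property gives z with t = a + z and s = b
    + z. A decomposition [w] of z turns both lists, with their heads, into a :: b :: w up to
    order. *)
Lemma exchange_perm (s t : seq B) : (forall p, p \in s -> P p) ->
  (forall p, p \in t -> P p) -> \sum_(p <- s) p = \sum_(p <- t) p -> perm_eq s t.
Proof.
have [n] := ubnP (size s); elim: n s t => // n IH [|a s] [|b t] szs sP tP //.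
- rewrite big_nil big_cons => /esym e.
  by case: (conP (tP b (mem_head _ _)) e).
- rewrite big_nil big_cons => e.
  by case: (conP (sP a (mem_head _ _)) e).
have sP' p : p \in s -> P p by move=> ps; apply: sP; rewrite in_cons ps orbT.
have tP' p : p \in t -> P p by move=> pt; apply: tP; rewrite in_cons pt orbT.
rewrite !big_cons => /exchP[||[-> e]|[z [tE sE]]]; first exact/sP/mem_head.
- exact/tP/mem_head.
- by rewrite perm_cons; apply: IH.
have [w [wP zE]] := genP z.
have aP : P a by exact/sP/mem_head.
have bP : P b by exact/tP/mem_head.
have sbw : perm_eq s (b :: w).
  apply: IH => //; last by rewrite big_cons -zE.
  by move=> p; rewrite in_cons => /orP[/eqP ->|/wP].
have awt : perm_eq (a :: w) t.
  apply: IH => //; last by rewrite big_cons -zE.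
    (* The induction bounds the first list only; a :: w has the length of [s] because b :: w is a
       permutation of [s]. *)
    by have := perm_size sbw; move: szs => /=; rewrite !ltnS => + <-.
  by move=> p; rewrite in_cons => /orP[/eqP ->|/wP].
apply: (@perm_trans _ (a :: b :: w)); first by rewrite perm_cons.
apply: (@perm_trans _ (b :: a :: w)); last by rewrite perm_cons.
by apply/permP => f /=; rewrite addnCA.
Qed.

Lemma exchange_free : free_abelian B.
Proof.
exists P => a; have [s [sP ->]] := genP a; exists (seq_mset s).
have mem p : (p \in seq_mset s) = (p \in s) by exact/perm_mem/perm_eq_seq_mset.
split.
  split; first by move=> p; rewrite mem => /sP.
  exact/perm_big/perm_eq_seq_mset.
move=> z [zP zE]; rewrite -[z]seq_mset_id; apply/eq_seq_msetP.
exact: exchange_perm.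
Qed.

Lemma exchange_can : cancellative B.
Proof.
move=> a x y; have [s [sP ->]] := genP a; have [t [tP ->]] := genP x.
have [u [uP ->]] := genP y; rewrite -!big_cat => /exchange_perm.
have catP (s1 s2 : seq B) : (forall p, p \in s1 -> P p) ->
   (forall p, p \in s2 -> P p) -> forall p, p \in s1 ++ s2 -> P p.
  by move=> h1 h2 p; rewrite mem_cat => /orP[/h1|/h2].
move=> /(_ (catP _ _ sP tP) (catP _ _ sP uP)); rewrite perm_cat2l => tu.
exact: perm_big.
Qed.

Lemma exchange_con (a b : B) : a + b = 0 -> a = 0.
Proof.
have [[|p s] [sP ->]] := genP a; first by rewrite big_nil.
by rewrite big_cons -addrA => /conP; case; apply/sP/mem_head.
Qed.

Lemma exchange_prime p : P p -> mprime p.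
Proof.
move=> Pp; split=> [[x]|a b]; first exact: conP.
have [s [sP ->]] := genP a; have [t [tP ->]] := genP b => -[c].
have [u [uP ->]] := genP c; rewrite -big_cat -(big_cons _ _ _ _ xpredT id).
move=> /exchange_perm st.
have /perm_mem/(_ p) : perm_eq (s ++ t) (p :: u).
  apply: st => q; first by rewrite mem_cat => /orP[/sP|/tP].
  by rewrite in_cons => /orP[/eqP ->|/uP].
rewrite mem_head mem_cat => /orP[] ps; [left|right];
  by rewrite (big_rem p) //=; eexists.
Qed.

End FreeMonoid.

(** * Finitely primary monoids of rank one *)

Section SteinitzMonoid.
Local Open Scope ring_scope.
Local Open Scope classical_set_scope.

(** Axioms modelled on V(C_proj): [deg] is the rank, [base] the class of R, [deg1_mul] the
    isomorphism of I + J with R + L, [deg1_can] the cancellation of R^n by determinants, and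
    [deg_compl] says that projective modules are summands of free ones. *)
Record steinitz (A : nmodType) := Steinitz {
  deg :> A -> nat;
  degD : forall x y, deg (x + y) = (deg x + deg y)%N;
  deg_eq0 : forall x, deg x = 0%N -> x = 0;
  base : A;
  deg_base : deg base = 1%N;
  deg1_gen : forall x, exists s : seq A,
    (forall g, g \in s -> deg g = 1%N) /\ x = \sum_(g <- s) g;
  deg1_mul : forall g h, deg g = 1%N -> deg h = 1%N ->
    exists2 k, deg k = 1%N & g + h = base + k;
  deg1_can : forall n g h, deg g = 1%N -> deg h = 1%N ->
    base *+ n + g = base *+ n + h -> g = h;
  deg_compl : forall x, exists y n, x + y = base *+ n }.

Variables (A : nmodType) (S : steinitz A).
Local Notation e := (base S).
Implicit Types x y g h k : A.

Lemma deg0 : S 0 = 0%N.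
Proof. by apply/eqP; rewrite -(eqn_add2l (S 0)) -degD addr0 addn0. Qed.

Lemma degMn x n : S (x *+ n) = (S x * n)%N.
Proof. by elim: n => [|n IH]; rewrite ?mulr0n ?muln0 ?deg0 // mulrSr degD IH mulnSr. Qed.

(* Adding [e] makes the normal form uniform: [x = 0] gets [g = e]. *)
Lemma normal_form x : exists2 g, S g = 1%N & x + e = e *+ S x + g.
Proof.
have [s [s1 ->]] := deg1_gen S x; elim: s s1 => [|h s IH] s1.
  by exists e; [exact: deg_base | rewrite big_nil deg0].
have [|g g1 gE] := IH; first by move=> g gs; apply: s1; rewrite in_cons gs orbT.
have h1 : S h = 1%N by exact/s1/mem_head.
have [k k1 kE] := deg1_mul h1 g1; exists k => //.
by rewrite big_cons -addrA gE degD h1 add1n mulrSr -!addrA -kE addrCA.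
Qed.

Lemma normal_formS x n : S x = n.+1 -> exists2 g, S g = 1%N & x = e *+ n + g.
Proof.
have [s [s1 ->]] := deg1_gen S x; case: s s1 => [|h s] s1; first by rewrite big_nil deg0.
have h1 : S h = 1%N by exact/s1/mem_head.
rewrite big_cons degD h1 add1n => -[<-].
elim: s h h1 s1 => [|h' s IH] h h1 s1.
  by exists h; rewrite // big_nil deg0 addr0 add0r.
have h'1 : S h' = 1%N by apply: s1; rewrite !in_cons eqxx orbT.
have [k k1 kE] := deg1_mul h1 h'1.
have [|g g1 gE] := IH k k1.
  by move=> g; rewrite in_cons => /orP[/eqP ->|gs] //; apply: s1; rewrite !in_cons gs !orbT.
by exists g; rewrite // big_cons addrA kE degD h'1 add1n mulrS -!addrA gE.
Qed.

(** The degrees agree, so the normal forms contain equally many copies of [e], and cancellation in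
    degree one suffices. *)
Lemma base_can n x y : e *+ n + x = e *+ n + y -> x = y.
Proof.
move=> xy; have degE : S x = S y.
  by apply/eqP; rewrite -(eqn_add2l (S (e *+ n))) -!degD xy.
case E : (S x) => [|d]; first by rewrite (deg_eq0 E) (deg_eq0 (etrans (esym degE) E)).
have [g g1 gE] := normal_formS E; rewrite degE in E.
have [h h1 hE] := normal_formS E.
move: xy; rewrite gE hE !addrA -mulrnDr => /deg1_can -> //.
Qed.

(** Every element divides a multiple of [e], and [e] can be cancelled. *)
Lemma steinitz_can : cancellative A.
Proof.
move=> x y z yz; have [x' [n xE]] := deg_compl S x.
by apply: (@base_can n); rewrite -xE addrAC yz addrAC.
Qed.

(** A complement of [g] in a multiple of [e] has a normal form e *+ d + h, and d copies of [e]
    cancel. A complement of degree 0 means that [g] is [e]. *)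
Lemma deg1_inv g : S g = 1%N -> exists2 h, S h = 1%N & g + h = e + e.
Proof.
move=> g1; have [x [n gx]] := deg_compl S g.
have degE : (1 + S x)%N = n by rewrite -g1 -degD gx degMn deg_base mul1n.
case E : (S x) => [|d].
  exists e; first exact: deg_base.
  by rewrite -{1}[g]addr0 -(deg_eq0 E) gx -degE E mulr1n.
have [h h1 hE] := normal_formS E; exists h => //.
apply: (@base_can d); rewrite addrCA -hE gx -degE E addrA -!mulrSr.
by rewrite add1n.
Qed.

(** In the group of degree one elements with unit [e], k is g h u^-1. *)
Lemma deg1_exchange u g h : S u = 1%N -> S g = 1%N -> S h = 1%N ->
  exists2 k, S k = 1%N & g + h = u + k.
Proof.
move=> u1 g1 h1; have [v v1 uv] := deg1_inv u1.
have [k k1 ghE] := deg1_mul g1 h1; have [l l1 kvE] := deg1_mul k1 v1.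
exists l => //; apply: (@steinitz_can v).
by rewrite addrC ghE -addrA kvE addrA -uv -addrA addrCA.
Qed.

(** For V(C_proj) this is the Picard group, realized inside the monoid itself. *)
Definition rank_one_group := {g : A | S g == 1%N}.
Local Notation Z := rank_one_group.

HB.instance Definition _ := gen_eqMixin Z.
HB.instance Definition _ := gen_choiceMixin Z.

Lemma rank_oneP (g : Z) : S (val g) = 1%N.
Proof. exact/eqP/(valP g). Qed.

Lemma rank_one_mul_ex (g h : Z) : exists k : Z, val g + val h = e + val k.
Proof.
have [k /eqP k1 kE] := deg1_mul (rank_oneP g) (rank_oneP h).
by exists (exist _ k k1).
Qed.

Lemma rank_one_inv_ex (g : Z) : exists k : Z, val k + val g = e + e.
Proof.
have [k /eqP k1 kE] := deg1_inv (rank_oneP g).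
by exists (exist _ k k1); rewrite addrC.
Qed.

(* The degree one elements form a group with unit [e], the product of [g] and
   [h] being the [k] with [g + h = e + k]. *)
Definition rank_one_mul (g h : Z) : Z := sval (cid (rank_one_mul_ex g h)).
Definition rank_one_inv (g : Z) : Z := sval (cid (rank_one_inv_ex g)).
Definition rank_one_base : Z := exist _ e (introT eqP (deg_base S)).

Lemma rank_one_mulE (g h : Z) : e + val (rank_one_mul g h) = val g + val h.
Proof. by rewrite /rank_one_mul; case: cid => k /= ->. Qed.

Lemma rank_one_mulC : commutative rank_one_mul.
Proof.
by move=> g h; apply/val_inj/(@steinitz_can e); rewrite !rank_one_mulE addrC.
Qed.

Lemma rank_one_mulA : associative rank_one_mul.
Proof.
move=> g h k; apply/val_inj/(@steinitz_can e)/(@steinitz_can e).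
by rewrite !rank_one_mulE addrCA [RHS]addrA !rank_one_mulE addrA.
Qed.

Lemma rank_one_mul1 : left_id rank_one_base rank_one_mul.
Proof. by move=> g; apply/val_inj/(@steinitz_can e); rewrite rank_one_mulE. Qed.

Lemma rank_one_mulV : left_inverse rank_one_base rank_one_inv rank_one_mul.
Proof.
move=> g; apply/val_inj/(@steinitz_can e); rewrite rank_one_mulE.
by rewrite /rank_one_inv; case: cid.
Qed.

HB.instance Definition _ := GRing.isZmodule.Build Z
  rank_one_mulA rank_one_mulC rank_one_mul1 rank_one_mulV.

Lemma rank_one_part_ex x : exists g : Z, x + e = e *+ S x + val g.
Proof.
have [g /eqP g1 gE] := normal_form x.
by exists (exist _ g g1).
Qed.

Definition rank_one_part x : Z := sval (cid (rank_one_part_ex x)).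

Lemma rank_one_partE x : x + e = e *+ S x + val (rank_one_part x).
Proof. by rewrite /rank_one_part; case: cid. Qed.

(** For a projective module these are the class of its determinant and its rank. *)
Definition steinitz_embed x : (Z * nat)%type := (rank_one_part x, S x).

Lemma steinitz_embed_additive : nmod_morphism steinitz_embed.
Proof.
have degE x y : e *+ S (x + y) = e *+ S x + e *+ S y by rewrite degD mulrnDr.
split.
  apply: pair_ext; last exact: deg0.
  by apply/val_inj/(@base_can (S 0)); rewrite -rank_one_partE deg0 add0r.
move=> x y; apply: pair_ext; last exact: degD.
apply/val_inj/(@base_can (S (x + y)))/(@steinitz_can e).
rewrite -rank_one_partE [RHS]addrCA rank_one_mulE degE addrACA -!rank_one_partE.
by rewrite addrACA addrC -addrA.
Qed.

HB.instance Definition _ := GRing.isNmodMorphism.Build A (Z * nat)%type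
  steinitz_embed steinitz_embed_additive.

Lemma steinitz_embed_inj : injective steinitz_embed.
Proof.
move=> x y [gE dE]; apply: (@steinitz_can e).
by rewrite !(addrC e) !rank_one_partE gE dE.
Qed.

End SteinitzMonoid.

(** * The factorial monoid Z x N for an abelian group Z *)

Section GroupTimesNat.
Local Open Scope ring_scope.
Local Open Scope classical_set_scope.
Local Open Scope mset_scope.
Variable Z : zmodType.
Local Notation F := (Z * nat)%type.
Implicit Types x y : F.

Definition gn_prime : F := (0, 1%N).

Lemma gn_primeMn n : gn_prime *+ n = (0, n).
Proof.
elim: n => // n IH; rewrite mulrS IH; apply: pair_ext => /=; first by rewrite addr0.
by rewrite [LHS]add1n.
Qed.

Lemma gn_can : cancellative F.
Proof.
move=> [a m] [b n] [c k] [/addrI -> /eqP].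
by rewrite eqn_add2l => /eqP ->.
Qed.

Lemma gn_unitP x : munit x <-> x.2 = 0%N.
Proof.
split=> [[y /(congr1 snd)/eqP]|x0]; first by rewrite /= addn_eq0 => /andP[/eqP].
by exists (- x.1, 0%N); apply: pair_ext; rewrite /= ?subrr // x0.
Qed.

Lemma gn_dvdP x : mdvd gn_prime x <-> (0 < x.2)%N.
Proof.
split=> [[y ->] //|]; case: x => a [|n] //= _; exists (a, n).
by apply: pair_ext; rewrite /= ?add0r // [RHS]add1n.
Qed.

Lemma gn_primeP : mprime gn_prime.
Proof.
split; first by move=> /gn_unitP.
by move=> a b; rewrite !gn_dvdP /= addn_gt0 => /orP[]; [left|right].
Qed.

Local Notation p := (red gn_prime).

Lemma redMn (H : nmodType) (a : H) n : red (a *+ n) = red a *+ n.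
Proof. by elim: n => [|n IH]; rewrite ?mulr0n // !mulrS -IH -redD. Qed.

(** The group component is a unit, so only the degree survives in the reduced monoid, which is thus
    a copy of N. *)
Lemma gn_red x : red x = p *+ x.2.
Proof.
rewrite -redMn gn_primeMn; apply/redP; exists (- x.1, 0%N); first exact/gn_unitP.
by apply: pair_ext; rewrite /= ?subrr // addr0.
Qed.

Lemma gn_redE (x : reduced F) : x = p *+ (repr x).2.
Proof. by rewrite -gn_red /red reprK. Qed.

Lemma gn_red_inj m n : p *+ m = p *+ n -> m = n.
Proof.
rewrite -!redMn => /redP[u /gn_unitP u0 /(congr1 snd)].
by rewrite !gn_primeMn /= u0 addr0.
Qed.

Lemma gn_atomP (u : reduced F) : matom u <-> u = p.
Proof.
have munitP n : munit (p *+ n) -> n = 0%N.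
  move=> [y]; rewrite [y]gn_redE -mulrnDr -(mulr0n p) => /gn_red_inj/eqP.
  by rewrite addn_eq0 => /andP[/eqP].
split=> [[uN ua]|->].
  have uE := gn_redE u.
  case E : (repr u).2 uE => [|[|n]] uE; first by case: uN; rewrite uE; exact: munit0.
    by rewrite uE mulr1n.
  by move: uE; rewrite mulrS => /ua[]; rewrite -1?[X in munit X]mulr1n => /munitP.
split; first by rewrite -[X in munit X]mulr1n => /munitP.
move=> b c; rewrite [b]gn_redE [c]gn_redE -mulrnDr -[X in X = _]mulr1n.
case: (repr b).2 => [|m]; first by left; exact: munit0.
case: (repr c).2 => [|n]; first by right; exact: munit0.
by move=> /gn_red_inj /eqP; rewrite addSn addnS.
Qed.

Lemma gn_factorial : factorial_monoid F.
Proof.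
have sumE n : \sum_(u <- (msetn n p : {mset reduced F})) u = p *+ n.
  by rewrite enum_msetn big_nseq iter_addr_0.
split; first exact: gn_can.
move=> x; exists (msetn x.2 p); split.
  by split=> [u /msetnP[_ ->]|]; [exact/gn_atomP | rewrite sumE (gn_red x)].
move=> z [za zs]; have zE : z = msetn (z p) p.
  apply/msetP => u; rewrite msetnE; case: eqP => [->//|uNp].
  by apply/mset_eq0P/negP => /za /gn_atomP.
by move: zs; rewrite {1}zE sumE (gn_red x) => /gn_red_inj <-.
Qed.

(** Elements of positive degree are exactly p F for the prime p = (0, 1). So the second hypothesis
    places the non-units in p F, and the third puts p F inside the image, whence exponent 1. *)
Lemma gn_finitely_primary (A : nmodType) (i : {additive A -> F}) :
  injective i -> (forall a, (i a).2 = 0%N -> munit a) ->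
  (forall y : F, (0 < y.2)%N -> exists a, i a = y) -> finitely_primary A 1 1.
Proof.
move=> i_inj iU iS; split=> //; exists F, i, (fun=> gn_prime); split.
- by split; [exact: gn_factorial | ].
- by split=> [_|j k _]; [exact: gn_primeP | rewrite !ord1].
- move=> x; exists ((x.1, 0%N), [ffun=> x.2]); split.
    split; first exact/gn_unitP.
    by rewrite big_ord1 ffunE gn_primeMn; apply: pair_ext; rewrite /= ?addr0 ?add0r.
  move=> [[a n] f] /= [/gn_unitP /= -> ->].
  rewrite big_ord1 gn_primeMn; congr pair.
    by apply: pair_ext; rewrite /= ?addr0.
  by apply/ffunP => j; rewrite ffunE [j]ord1.
- move=> a aN; rewrite big_ord1; apply/gn_dvdP; rewrite lt0n.
  by apply/eqP => /iU/aN.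
- move=> y; rewrite big_ord1 mulr1n; apply: iS => /=.
  by rewrite [X in (0 < X)%N]add1n.
Qed.

End GroupTimesNat.

Lemma steinitz_finitely_primary (A : nmodType) (S : steinitz A) :
  finitely_primary A 1 1.
Proof.
apply: (@gn_finitely_primary (rank_one_group S) A (steinitz_embed S)).
- exact: steinitz_embed_inj.
- by move=> a /deg_eq0 ->; exact: munit0.
(* In degree n + 1 the preimage is the normal form, for modules R^n + I. *)
- move=> [g [|n]] // _; exists (base S *+ n + val g)%R.
  have degE : S (base S *+ n + val g)%R = n.+1.
    by rewrite degD degMn deg_base rank_oneP mul1n addn1.
  apply: pair_ext => //=.
  apply/val_inj/(@base_can _ S n.+1); rewrite -degE -rank_one_partE degE.
  by rewrite addrAC -mulrSr.
Qed.

(** * Products of a finitely primary and a free monoid *)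

Section ReducedConical.
Local Open Scope ring_scope.
Local Open Scope classical_set_scope.
Variable H : nmodType.
Hypothesis conH : forall a b : H, a + b = 0 -> a = 0.
Local Notation G := (reduced H).

Lemma red_addE (a b : H) : red a + red b = red (a + b).
Proof. exact: redD. Qed.

(** With no unit besides 0, the reduced monoid is a copy of [H]; the lemmas below move divisibility,
    atoms and primes between the two. *)
Lemma red_inj : injective (@red H).
Proof. by move=> a b /redP[u [v /conH ->] ->]; rewrite addr0. Qed.

Lemma red_ex (x : G) : exists a, x = red a.
Proof. by exists (repr x); rewrite /red reprK. Qed.

Lemma red_cancellative : cancellative H -> cancellative G.
Proof.
move=> canH x y z; have [a ->] := red_ex x; have [b ->] := red_ex y.
by have [c ->] := red_ex z => /=; rewrite !red_addE => /red_inj e; rewrite (canH _ _ _ e).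
Qed.

Lemma red_conical (x y : G) : x + y = 0 -> x = 0.
Proof.
have [a ->] := red_ex x; have [b ->] := red_ex y.
by rewrite red_addE => /red_inj e; rewrite (conH e).
Qed.

Lemma red_dvd (a b : H) : mdvd (red a) (red b) <-> mdvd a b.
Proof.
split=> [[x]|[c ->]]; last by exists (red c); rewrite red_addE.
by have [c ->] := red_ex x; rewrite red_addE => /red_inj ->; exists c.
Qed.

Lemma red_unit (a : H) : munit (red a) <-> munit a.
Proof.
split=> [[x]|[c ac]]; last by exists (red c); rewrite red_addE ac.
by have [c ->] := red_ex x; rewrite red_addE => /red_inj ac; exists c.
Qed.

Lemma red_atom (a : H) : matom (red a) <-> matom a.
Proof.
split=> -[ua aa]; split.
- by rewrite -red_unit.
- move=> b c aE; have /aa : red a = red b + red c by rewrite aE red_addE.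
  by rewrite !red_unit.
- by rewrite red_unit.
- move=> x y; have [b ->] := red_ex x; have [c ->] := red_ex y.
  by rewrite red_addE => /red_inj/aa; rewrite !red_unit.
Qed.

Lemma red_prime (a : H) : mprime a -> mprime (red a).
Proof.
move=> [ua aa]; split; first by rewrite red_unit.
move=> x y; have [b ->] := red_ex x; have [c ->] := red_ex y.
by rewrite red_addE !red_dvd; exact: aa.
Qed.

Lemma red_sum (s : seq H) : red (\sum_(a <- s) a) = \sum_(x <- map red s) x.
Proof.
elim: s => [|a s IH]; first by rewrite !big_nil.
by rewrite /= !big_cons -IH red_addE.
Qed.

End ReducedConical.

Section Product.
Local Open Scope ring_scope.
Local Open Scope classical_set_scope.
Variables (A B H : nmodType) (i : {additive A -> H}) (j : {additive B -> H}).
Hypothesis prodH : internal_product i j.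
Variables (S : steinitz A) (P : set B).
Hypothesis exchP : forall a b x y : B, P a -> P b -> a + x = b + y ->
  (a = b /\ x = y) \/ exists z, y = a + z /\ x = b + z.
Hypothesis genP : forall x : B, exists s : seq B,
  (forall p, p \in s -> P p) /\ x = \sum_(p <- s) p.
Hypothesis conP : forall a x : B, P a -> a + x <> 0.

Lemma product_ex (x : H) : exists a b, x = i a + j b.
Proof. by have [[a b] [xE _]] := prodH x; exists a, b. Qed.

Lemma product_inj a b a' b' : i a + j b = i a' + j b' -> a = a' /\ b = b'.
Proof.
move=> e; have [ab [_ u]] := prodH (i a + j b).
by have := u (a, b) erefl; rewrite (u (a', b') e) => -[-> ->].
Qed.

Lemma productD a b a' b' :
  (i a + j b) + (i a' + j b') = i (a + a') + j (b + b').
Proof. by rewrite !raddfD addrACA. Qed.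

Lemma product_eq0 a b : i a + j b = 0 -> a = 0 /\ b = 0.
Proof. by move=> e; apply: product_inj; rewrite e !raddf0 addr0. Qed.

Lemma product_con (x y : H) : x + y = 0 -> x = 0.
Proof.
have [a [b ->]] := product_ex x; have [a' [b' ->]] := product_ex y.
rewrite productD => /product_eq0[aa' bb'].
have a0 : a = 0.
  apply: (deg_eq0 (s := S)); have /(congr1 S) := aa'; rewrite degD deg0 => /eqP.
  by rewrite addn_eq0 => /andP[/eqP].
by rewrite a0 (exchange_con genP conP bb') !raddf0 addr0.
Qed.

Lemma product_can : cancellative H.
Proof.
move=> x y z; have [a [b ->]] := product_ex x; have [a' [b' ->]] := product_ex y.
have [a'' [b'' ->]] := product_ex z; rewrite !productD => /product_inj[].
by move=> /(steinitz_can S) -> /(exchange_can exchP genP conP) ->.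
Qed.

(** Degrees add and [B] is conical, so of two summands one has degree 0 and trivial [B]-part. *)
Lemma product_deg1_atom g : S g = 1%N -> matom (i g).
Proof.
move=> g1; split=> [[x gx]|x y].
  have [|g0 _] := @product_eq0 g 0; first by rewrite (product_con gx) raddf0 addr0.
  by rewrite g0 deg0 in g1.
have [a [b ->]] := product_ex x; have [a' [b' ->]] := product_ex y.
have -> : i g = i g + j 0 by rewrite raddf0 addr0.
rewrite productD => /product_inj[gE /esym bE].
have b0 := exchange_con genP conP bE; have b'0 : b' = 0 by rewrite -bE b0 add0r.
move: g1; rewrite gE degD b0 b'0 !raddf0 !addr0.
case E : (S a) => [|n]; first by left; rewrite (deg_eq0 E) raddf0; exact: munit0.
case E' : (S a') => [|m]; last by rewrite addSn addnS.
by right; rewrite (deg_eq0 E') raddf0; exact: munit0.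
Qed.

Lemma product_dvd_tor p a b : mdvd (j p) (i a + j b) <-> mdvd p b.
Proof.
split=> [[x]|[c ->]]; last by exists (i a + j c); rewrite raddfD addrCA.
have [a' [b' ->]] := product_ex x; have -> : j p = i 0 + j p by rewrite raddf0 add0r.
by rewrite productD; move=> /product_inj[_ ->]; exists b'.
Qed.

Lemma product_prime p : P p -> mprime (j p).
Proof.
move=> /(exchange_prime exchP genP conP)[up pp]; split.
  move=> [x px]; apply: up; exists 0; rewrite addr0.
  by have [|_ ->] := @product_eq0 0 p; rewrite // (product_con px) raddf0 addr0.
move=> x y; have [a [b ->]] := product_ex x; have [a' [b' ->]] := product_ex y.
by rewrite productD !product_dvd_tor; exact: pp.
Qed.

Lemma prime_atom (K : nmodType) (q : K) :
  cancellative K -> (forall a b : K, a + b = 0 -> a = 0) -> mprime q -> matom q.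
Proof.
move=> canK conK [uq pq]; split=> // b c qE.
have : mdvd q (b + c) by exists 0; rewrite addr0 qE.
case/pq=> [][d dE]; [right | left].
  have : d + c = 0 by apply: (canK q); rewrite addrA -dE -qE addr0.
  by rewrite addrC => /conK ->; exact: munit0.
have : d + b = 0 by apply: (canK q); rewrite addrA -dE addrC -qE addr0.
by rewrite addrC => /conK ->; exact: munit0.
Qed.

Lemma product_gen (x : H) : exists s : seq H, x = \sum_(u <- s) u /\
  forall u, u \in s -> (exists2 g, S g = 1%N & u = i g) \/ exists2 p, P p & u = j p.
Proof.
have [a [b ->]] := product_ex x; have [s [s1 ->]] := deg1_gen S a.
have [t [tP ->]] := genP b; exists (map i s ++ map j t).
rewrite big_cat !big_map !raddf_sum; split=> // u; rewrite mem_cat.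
case/orP=> /mapP[v vs ->]; [left|right]; exists v => //; [exact: s1|exact: tP].
Qed.

(** Generators of [B] become primes and degree one elements of [A] form [E]. The alternative is
    decided by whether [E] contains two different elements. *)
Lemma product_factorizations : half_factorial H /\ (factorial_monoid H \/
  (catenary_degree H = Some 2%N /\ tame_degree H = Some 2%N)).
Proof.
have conH := product_con; have canH := product_can.
pose E : set (reduced H) := [set red (i g) | g in [set g | S g = 1%N]].
have canG := red_cancellative conH canH; have conG := red_conical conH.
have gen_atom (u : H) : (exists2 g, S g = 1%N & u = i g) \/ (exists2 p, P p & u = j p) ->
    matom u.
  move=> [[g g1 ->]|[p Pp ->]]; first exact: product_deg1_atom.
  exact/prime_atom/product_prime.
have atmG (x : reduced H) : exists z, factorizations x z.
  have [a ->] := red_ex x; have [s [-> sP]] := product_gen a.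
  exists (seq_mset (map red s)); split.
    move=> u; rewrite (perm_mem (perm_eq_seq_mset _)) => /mapP[v vs ->].
    by apply/red_atom => //; apply/gen_atom/sP.
  by rewrite (perm_big _ (perm_eq_seq_mset _)) red_sum.
have prime_or_E (u : reduced H) : matom u -> mprime u \/ E u.
  have [a ->] := red_ex u => /(red_atom conH)[ua aa].
  (* The first generator in a decomposition of an atom is not a unit, so it is the whole atom. *)
  have [[|v s] [aE sP]] := product_gen a.
    by case: ua; rewrite aE big_nil; exact: munit0.
  have vP := sP v (mem_head _ _).
  rewrite big_cons in aE; case: (aa _ _ aE) => [uv|[w /conH w0]].
    by case: (gen_atom v vP).
  rewrite w0 addr0 in aE; rewrite aE.
  case: vP => [[g g1 ->]|[p Pp ->]]; first by right; exists g.
  by left; apply/(red_prime conH)/product_prime.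
have atomE (u : reduced H) : E u -> matom u.
  by move=> [g g1 <-]; apply/(red_atom conH)/product_deg1_atom.
have exchE (u g h : reduced H) : E u -> E g -> E h -> exists2 k, E k & g + h = u + k.
  move=> [u' u1 <-] [g' g1 <-] [h' h1 <-].
  have [k k1 kE] := deg1_exchange u1 g1 h1; exists (red (i k)); first by exists k.
  by rewrite !red_addE -!raddfD kE.
split; first exact: exchange_half_factorial canG conG atmG prime_or_E atomE exchE canH.
have [sub|] := pselect (forall g h, E g -> E h -> g = h).
  by left; apply: exchange_factorial canG conG atmG prime_or_E atomE exchE canH sub.
move=> /existsNP[e /existsNP[g /not_implyP[Ee /not_implyP[Eg eg]]]]; right.
exact: (exchange_degrees canG conG prime_or_E atomE exchE Ee Eg eg).
Qed.

End Product.

(** * Ideals of h-local domains *)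

Section Ideals.
Local Open Scope ring_scope.
Local Open Scope classical_set_scope.
Variable R : idomainType.
Implicit Types I J K m P S : set R.

Definition principal (a : R) : set R := [set x | exists c, x = c * a].

Lemma principal_ideal a : ideal (principal a).
Proof.
split; first by exists 0; rewrite mul0r.
by move=> r _ _ [c ->] [d ->]; exists (r * c + d); rewrite mulrDl mulrA.
Qed.

Lemma idealM I a x : ideal I -> I x -> I (a * x).
Proof. by move=> [I0 Il] Ix; rewrite -[_ * _]addr0; exact: Il. Qed.

Lemma idealD I x y : ideal I -> I x -> I y -> I (x + y).
Proof. by move=> [I0 Il] Ix Iy; rewrite -[x]mul1r; exact: Il. Qed.

Lemma idealB I x y : ideal I -> I x -> I y -> I (x - y).
Proof.
by move=> hI Ix Iy; apply: idealD => //; rewrite -mulN1r; exact: idealM.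
Qed.

Lemma ideal_sum I (T : Type) (s : seq T) (Q : pred T) (f : T -> R) : ideal I ->
  (forall i, Q i -> I (f i)) -> I (\sum_(i <- s | Q i) f i).
Proof. by move=> hI If; elim/big_ind: _ => [|x y|] //; [case: hI | exact: idealD]. Qed.

Definition ideal_adjoin I x : set R := [set y | exists i r, I i /\ y = i + r * x].

Lemma ideal_adjoinP I x : ideal I ->
  [/\ ideal (ideal_adjoin I x), I `<=` ideal_adjoin I x & ideal_adjoin I x x].
Proof.
move=> hI; have [I0 Il] := hI; split.
- split; first by exists 0, 0; rewrite mul0r addr0.
  move=> a _ _ [i [r [Ii ->]]] [j [s [Ij ->]]].
  exists (a * i + j), (a * r + s); split; first exact: Il.
  by rewrite mulrDr mulrDl addrACA mulrA.
- by move=> i Ii; exists i, 0; rewrite mul0r addr0.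
- by exists 0, 1; rewrite mul1r add0r.
Qed.

Lemma max_disjoint_ideal I S : ideal I -> (forall x, I x -> ~ S x) ->
  exists J, [/\ ideal J, I `<=` J, forall x, J x -> ~ S x &
    forall K, ideal K -> J `<=` K -> (forall x, K x -> ~ S x) -> K = J].
Proof.
move=> hI IS; pose Q J := J = set0 \/ [/\ ideal J, I `<=` J & forall x, J x -> ~ S x].
have [|J [QJ Jmax]] := @Zorn_bigcup R Q.
  move=> F FQ tF.
  have [[X [FX [x Xx]]]|Fe] := pselect (exists X, F X /\ X !=set0); last first.
    left; rewrite -subset0 => y [X FX Xy]; case: Fe; exists X; split=> //; by exists y.
  have hX Y y : F Y -> Y y -> [/\ ideal Y, I `<=` Y & forall x, Y x -> ~ S x].
    by move=> FY Yy; have [Y0|//] := FQ _ FY; rewrite Y0 in Yy.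
  right; split.
  - split; first by exists X => //; case: (hX _ _ FX Xx) => -[].
    move=> a y z [Y FY Yy] [Z FZ Zz].
    have [YZ|ZY] := tF _ _ FY FZ.
      by exists Z => //; case: (hX _ _ FZ Zz) => -[_ +] _ _; apply=> //; exact: YZ.
    by exists Y => //; case: (hX _ _ FY Yy) => -[_ +] _ _; apply=> //; exact: ZY.
  - by move=> y Iy; exists X => //; case: (hX _ _ FX Xx) => _ + _; apply.
  - by move=> y [Y FY Yy]; case: (hX _ _ FY Yy) => _ _; apply.
have [J0|[hJ IJ JS]] := QJ.
  case: (Jmax I); last by right; split.
  rewrite J0; split=> // I0; have := I0 0; apply; by case: hI.
exists J; split=> // K hK JK KS; apply: contrapT => KJ.
apply: (Jmax K); last by right; split=> // x /IJ /JK.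
by split=> // KJ'; apply: KJ; apply/seteqP.
Qed.

Lemma ex_maximal_ideal I : ideal I -> ~ I 1 -> exists2 m, maximal_ideal m & I `<=` m.
Proof.
move=> hI I1; have [|J [hJ IJ J1 Jmax]] := @max_disjoint_ideal I [set 1] hI.
  by move=> x Ix /= x1; apply: I1; rewrite -x1.
exists J => //; split=> // [J1'|K hK JK]; first exact: (J1 1).
have [K1|K1] := pselect (K 1); [right|left].
  by apply/seteqP; split=> // x _; rewrite -[x]mulr1; exact: idealM.
by apply: Jmax => // x Kx /= x1; apply: K1; rewrite -x1.
Qed.

(** An ideal maximal among those disjoint from [S] is prime: if it contained a product but neither
    factor, adjoining each factor would produce an element of [S], and the product of these two
    would lie in the ideal. *)
Lemma ex_prime_ideal I S : ideal I -> S 1 -> (forall x y, S x -> S y -> S (x * y)) ->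
  (forall x, I x -> ~ S x) ->
  exists P, [/\ prime_ideal P, I `<=` P & forall x, P x -> ~ S x].
Proof.
move=> hI S1 SM IS; have [P [hP IP PS Pmax]] := max_disjoint_ideal hI IS.
exists P; split=> //; split=> // [/PS//|a b Pab].
have meet x : ~ P x -> exists i r, P i /\ S (i + r * x).
  move=> Px; have [hK PK Kx] := ideal_adjoinP x hP.
  apply: contrapT => nS; apply: Px; rewrite -(Pmax _ hK PK) // => y [i [r [Pi yE]]] Sy.
  by apply: nS; exists i, r; rewrite -yE.
have [Pa|/meet[i [r [Pi Sa]]]] := pselect (P a); first by left.
have [Pb|/meet[j [s [Pj Sb]]]] := pselect (P b); first by right.
case: (PS ((i + r * a) * (j + s * b))); last exact: SM.
rewrite mulrDl mulrDr -!addrA; apply: idealD => //; first by rewrite mulrC; exact: idealM.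
apply: idealD => //; first by rewrite mulrC; exact: idealM.
rewrite mulrDr; apply: idealD => //; first exact: idealM.
by rewrite mulrACA; exact: idealM.
Qed.

Lemma maximal_inv m x : maximal_ideal m -> ~ m x -> exists r, m (1 - r * x).
Proof.
move=> [hm m1 mmax] mx; have [hK mK Kx] := ideal_adjoinP x hm.
have [Km|KT] := mmax _ hK mK; first by case: mx; rewrite -Km.
have : ideal_adjoin m x 1 by rewrite KT.
by move=> [i [r [mi ->]]]; exists r; rewrite addrK.
Qed.

Lemma maximal_prime m : maximal_ideal m -> forall x y, ~ m x -> ~ m y -> ~ m (x * y).
Proof.
move=> hm x y mx my mxy; have [r mr] := maximal_inv hm mx; case: my.
have [hI _ _] := hm; have -> : y = y * (1 - r * x) + r * (x * y).
  by rewrite mulrBr mulr1 mulrA (mulrC y) -mulrA subrK.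
by apply: idealD => //; exact: idealM.
Qed.

Lemma maximal_prod m (T : eqType) (s : seq T) (Q : pred T) (f : T -> R) :
  maximal_ideal m -> (forall i, i \in s -> Q i -> ~ m (f i)) ->
  ~ m (\prod_(i <- s | Q i) f i).
Proof.
move=> hm mf; rewrite big_seq_cond; apply: (big_ind (fun x => ~ m x)).
- by case: hm.
- exact: maximal_prime.
- by move=> i /andP[]; exact: mf.
Qed.

Lemma unit_mod I x : ideal I -> (forall m, maximal_ideal m -> I `<=` m -> ~ m x) ->
  exists r, I (1 - r * x).
Proof.
move=> hI mx; have [hK IK Kx] := ideal_adjoinP x hI.
have [K1|K1] := pselect (ideal_adjoin I x 1).
  by have [i [r [Ii ->]]] := K1; exists r; rewrite addrK.
have [m hm Km] := ex_maximal_ideal hK K1.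
by case: (mx m hm); [move=> y /IK/Km | exact: Km].
Qed.

(** Elementwise form of R/I being local or zero: r or 1 - r is invertible modulo [I]. *)
Definition local_ideal I := ideal I /\
  forall r, exists c, I (1 - c * r) \/ I (1 - c * (1 - r)).

Section HLocal.
Hypothesis R_hloc : h_local R.

(** Otherwise some prime ideal contains [a] and avoids all products s t with s outside [m] and t
    outside [m']. It then lies in both [m] and [m'], against the uniqueness in [h_local]. *)
Lemma hlocal_separate a m m' : a != 0 -> maximal_ideal m -> maximal_ideal m' ->
  m <> m' -> exists s t, [/\ ~ m s, ~ m' t & principal a (s * t)].
Proof.
move=> a0 hm hm' mm'; apply: contrapT => nst.
pose S := [set x | exists s t, [/\ ~ m s, ~ m' t & x = s * t]].
have m1 : ~ m 1 by case: hm.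
have m'1 : ~ m' 1 by case: hm'.
have [||||P [hP aP PS]] := @ex_prime_ideal (principal a) S.
- exact: principal_ideal.
- by exists 1, 1; rewrite mulr1.
- move=> _ _ [s [t [ms m't ->]]] [s' [t' [ms' m't' ->]]].
  exists (s * s'), (t * t'); split; rewrite 1?mulrACA //; exact: maximal_prime.
- by move=> x ax [s [t [ms m't xE]]]; apply: nst; exists s, t; rewrite -xE.
have Pa : P a by apply: aP; exists 1; rewrite mul1r.
have PN0 : P <> [set 0] by move=> P0; move: Pa; rewrite P0 /= => /eqP; rewrite (negbTE a0).
have [n [_ nU]] := (proj2 R_hloc) P hP PN0; apply: mm'.
rewrite -(nU m); last first.
  by split=> // x Px; apply: contrapT => mx; apply: (PS x Px); exists x, 1; rewrite mulr1.
apply: nU; split=> // x Px; apply: contrapT => mx.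
by apply: (PS x Px); exists 1, x; rewrite mul1r.
Qed.

(** Each of the finitely many maximal ideals m over [a] gets a product u_m of separating elements,
    outside m and with u_m u_m' in Ra for m' different from m. So u_m lies in all the other m', and
    no maximal ideal over [a] contains the sum of the u_m, which can be scaled to 1 modulo [a]. *)
Lemma hlocal_idempotents a : a != 0 -> exists es : seq R,
  [/\ principal a (1 - \sum_(e <- es) e),
      pairwise (fun e e' => `[<principal a (e * e')>]) es &
      forall e, e \in es -> local_ideal (ideal_adjoin (principal a) (1 - e))].
Proof.
move=> a0; have /finite_seqP[s0 s0E] := (proj1 R_hloc) a a0.
pose s := undup s0; have sP m : m \in s <-> maximal_ideal m /\ m a.
  rewrite mem_undup; have : [set` s0] m = (maximal_ideal m /\ m a) by rewrite -s0E.
  by move=> /= ->.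
have ha := principal_ideal a.
have /choice[st stP] (mm : set R * set R) : exists st : R * R,
    mm.1 \in s -> mm.2 \in s -> mm.1 <> mm.2 ->
    [/\ ~ mm.1 st.1, ~ mm.2 st.2 & principal a (st.1 * st.2)].
  have [[m1 [m2 m12]]|n] := pselect (mm.1 \in s /\ mm.2 \in s /\ mm.1 <> mm.2); last first.
    by exists (0, 0) => *; case: n.
  have /sP[h1 _] := m1; have /sP[h2 _] := m2.
  by have [x [y xy]] := hlocal_separate a0 h1 h2 m12; exists (x, y).
(* The choices for (m, m') and (m', m) are unrelated; combining both gives elements outside [m] with
   [x m m' * x m' m] in Ra. *)
pose x m m' := (st (m, m')).1 * (st (m', m)).2.
have xN m m' : m \in s -> m' \in s -> m != m' -> ~ m (x m m').
  move=> ms m's /eqP mm'; have [h1 _ _] := stP (m, m') ms m's mm'.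
  have [_ h2 _] := stP (m', m) m's ms (nesym mm').
  by apply: maximal_prime => //; case/sP: ms.
have xx m m' : m \in s -> m' \in s -> m != m' -> principal a (x m m' * x m' m).
  move=> ms m's /eqP mm'; have [_ _ h] := stP (m, m') ms m's mm'.
  have -> : x m m' * x m' m =
    (st (m', m)).2 * (st (m', m)).1 * ((st (m, m')).1 * (st (m, m')).2).
    by rewrite /x (mulrC (st (m, m')).1) mulrACA.
  exact: idealM.
pose u m := \prod_(m' <- s | m' != m) x m m'.
have uN m : m \in s -> ~ m (u m).
  move=> ms; apply: maximal_prod => [|m' m's m'm]; first by case/sP: ms.
  by apply: xN; rewrite // eq_sym.
have s_uniq : uniq s := undup_uniq s0.
have uu m m' : m \in s -> m' \in s -> m != m' -> principal a (u m * u m').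
  have uE n n' : n' \in s -> n' != n -> exists c, u n = x n n' * c.
    by move=> n's n'n; rewrite /u (big_rem n') //= n'n; eexists.
  move=> ms m's mm'; have [|c ->] := uE m m' m's; first by rewrite eq_sym.
  have [d ->] := uE m' m ms mm'.
  by rewrite mulrACA mulrC; apply: idealM => //; exact: xx.
have ua m x' : m \in s -> principal a x' -> m x'.
  by move=> /sP[[hm _ _] ma] [c ->]; exact: idealM.
have u_mem m m' : m \in s -> m' \in s -> m != m' -> m' (u m).
  move=> ms m's mm'; apply: contrapT => mu.
  have [hm' _] := (proj1 (sP m') m's).
  by apply: (maximal_prime hm' mu (uN _ m's)); by apply: ua => //; exact: uu.
pose v := \sum_(m <- s) u m.
have vN m : m \in s -> ~ m v.
  move=> ms; rewrite /v (bigD1_seq m) //= => mv; apply: (uN m ms).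
  have [[hm _ _] _] := proj1 (sP m) ms.
  rewrite -[u m](addrK (\sum_(i <- s | i != m) u i)); apply: idealB => //.
  rewrite big_seq_cond; apply: ideal_sum => // m' /andP[m's m'm].
  exact: u_mem.
have [|w aw] := @unit_mod (principal a) v ha.
  by move=> m hm am; apply: vN; apply/sP; split=> //; apply: am; exists 1; rewrite mul1r.
exists [seq w * u m | m <- s]; split.
- by rewrite big_map -mulr_sumr.
- rewrite pairwise_map; move: s_uniq; rewrite uniq_pairwise.
  apply: (@sub_in_pairwise _ (mem s)); last exact/allP.
  move=> m m' ms m's /= mm'; apply/asboolP; rewrite mulrACA.
  by apply: idealM => //; exact: uu.
- move=> _ /mapP[m ms ->]; set e := w * u m.
  have [hI aI Ie] := ideal_adjoinP (1 - e) ha; split=> // r.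
  have [hm ma] := proj1 (sP m) ms.
  (* The only maximal ideal that can contain [a] and 1 - e is [m]: any other one over [a] contains
     [u m], hence e, hence 1. *)
  have inv_r q : ~ m q -> exists c, ideal_adjoin (principal a) (1 - e) (1 - c * q).
    move=> mq; apply: unit_mod => // n hn In.
    have na : n a by apply/In/aI; exists 1; rewrite mul1r.
    have ns : n \in s by apply/sP.
    have [<-//|/eqP mn] := pselect (m = n).
    have [hn' n1 _] := hn; case: n1; rewrite -[1](subrK e); apply: idealD => //.
      exact: In.
    by apply: idealM => //; exact: u_mem.
  have [/inv_r[c cI]|mr] := pselect (~ m r); first by exists c; left.
  have [|c cI] := inv_r (1 - r); last by exists c; right.
  have [hm' m1 _] := hm; move=> m1r; apply: m1; rewrite -[1](subrK r).
  by apply: idealD => //; exact: contrapT.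
Qed.

End HLocal.
End Ideals.

(** * Invertible ideals *)

Section Inverses.
Local Open Scope ring_scope.
Local Open Scope classical_set_scope.
Variable R : idomainType.
Implicit Types I J : set R.
Local Notation K := {fraction R}.
Local Notation tofrac := (@tofrac R).

Lemma tofrac_inj : injective tofrac.
Proof. by move=> x y /eqP; rewrite tofrac_eq => /eqP. Qed.

Lemma fraction_den (z : K) : exists n d, d != 0 /\ z * tofrac d = tofrac n.
Proof.
elim/quotW: z => x; exists \n_x, \d_x; split; first exact: denom_ratioP.
apply/eqP; rewrite !piE /= FracField.equivfE /= !numden_Ratio ?mulr1 ?oner_neq0 ?denom_ratioP //.
by rewrite mulrC.
Qed.

Lemma common_den (T : finType) (z : T -> K) :
  exists2 d, d != 0 & exists l : T -> R, forall t, z t * tofrac d = tofrac (l t).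
Proof.
have /choice[nd ndP] (t : T) : exists nd : R * R,
    nd.2 != 0 /\ z t * tofrac nd.2 = tofrac nd.1.
  by have [n [d h]] := fraction_den (z t); exists (n, d).
exists (\prod_t (nd t).2); first by apply/prodf_neq0 => t _; case: (ndP t).
exists (fun t => (nd t).1 * \prod_(s | s != t) (nd s).2) => t.
rewrite (bigD1 t) //= !tofracM mulrA; congr (_ * _).
by case: (ndP t).
Qed.

(** Write 1 as the sum of a_k g_k with g_k in the inverse of [I]; then [d] is a common denominator
    and l_k = d g_k. Later arguments on inverses can thus stay inside R. *)
Lemma invertible_inverse I : invertible_ideal I ->
  exists d m (a l : 'I_m -> R), [/\ d != 0, forall k, I (a k),
    \sum_k a k * l k = d & forall x k, I x -> principal d (l k * x)].
Proof.
move=> [hI [J [J0 Jl] IJ]].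
have : range tofrac 1 by exists 1 => //; rewrite tofrac1.
rewrite -IJ => -[m [f [g [fI gJ fg]]]].
have /choice[a aE] (k : 'I_m) : exists a, I a /\ tofrac a = f k.
  by have [a Ia aE] := fI k; exists a.
have [d d0 [l lE]] := common_den g.
exists d, m, a, l; split=> //; first by move=> k; case: (aE k).
  apply: tofrac_inj; rewrite rmorph_sum -[RHS]mul1r fg mulr_suml.
  by apply: eq_bigr => k _; case: (aE k) => _ <-; rewrite rmorphM /= -lE mulrA.
move=> x k Ix; have : set_mul (tofrac @` I) J (tofrac x * g k).
  exists 1%N, (fun=> tofrac x), (fun=> g k); split; last by rewrite big_ord1.
  - by move=> _; exists x.
  - by [].
rewrite IJ => -[c _ cE]; exists c; apply: tofrac_inj.
by rewrite !rmorphM /= cE -lE [LHS]mulrC mulrA.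
Qed.

Lemma gen_ideal_mem n (g : 'I_n -> R) i : gen_ideal g (g i).
Proof.
exists (fun j => (j == i)%:R); rewrite (bigD1 i) //= eqxx mul1r big1 ?addr0 //.
by move=> j /negbTE ->; rewrite mul0r.
Qed.

(** This makes x and y comparable wherever a or 1 - a is invertible. With u x + v y = d and u, v in
    [d] times the inverse of (x, y), take a = u x / d, b = u y / d and c = v x / d. *)
Lemma prufer_pair : prufer R -> forall x y : R,
  exists a b c, a * y = b * x /\ (1 - a) * x = c * y.
Proof.
move=> R_pru x y; pose g (i : 'I_2) := if i == 0 then x else y.
have gE c : \sum_i c i * g i = c 0 * x + c 1 * y.
  by rewrite !big_ord_recl big_ord0 addr0 /g /=; congr (_ + c _ * _); apply/val_inj.
have Ix : gen_ideal g x by have := gen_ideal_mem g 0.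
have Iy : gen_ideal g y by have := gen_ideal_mem g 1.
have [g0|/R_pru/invertible_inverse[d [m [a [l [d0 Ia al lI]]]]]] :=
    pselect (gen_ideal g = [set 0]).
  exists 0, 0, 0; move: Ix Iy; rewrite g0 /= => -> ->.
  by rewrite !mulr0.
have /choice[c cE] (k : 'I_m) : exists c, a k = c.1 * x + c.2 * y.
  by have [c ->] := Ia k; rewrite gE; exists (c 0, c 1).
pose u := \sum_k l k * (c k).1; pose v := \sum_k l k * (c k).2.
have uvE : u * x + v * y = d.
  rewrite /u /v !mulr_suml -big_split -al; apply: eq_bigr => k _ /=.
  by rewrite cE mulrDl [in RHS]mulrC [X in _ = _ + X]mulrC !mulrA.
have div w z : gen_ideal g z -> exists q, (\sum_k l k * w k) * z = q * d.
  move=> Iz; have /choice[q qE] (k : 'I_m) : exists q, l k * z = q * d by exact: lI.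
  exists (\sum_k q k * w k); rewrite !mulr_suml; apply: eq_bigr => k _.
  by rewrite mulrAC qE mulrAC.
have [q1 e1] := div (fun k => (c k).1) x Ix.
have [q2 e2] := div (fun k => (c k).1) y Iy.
have [q3 e3] := div (fun k => (c k).2) x Ix.
have [q4 e4] := div (fun k => (c k).2) y Iy.
have sum1 : q1 + q4 = 1.
  by apply: (mulIf d0); rewrite mulrDl -e1 -e4 mul1r.
exists q1, q2, q3; split.
  by apply: (mulIf d0); rewrite mulrAC -e1 [RHS]mulrAC -e2 mulrAC.
have -> : 1 - q1 = q4 by rewrite -sum1 addrAC subrr add0r.
by apply: (mulIf d0); rewrite mulrAC -e4 [RHS]mulrAC -e3 mulrAC.
Qed.

End Inverses.

(** * Decomposition of torsion modules *)

Section ClassSums.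
Local Open Scope ring_scope.
Local Open Scope classical_set_scope.
Variables (R : idomainType) (C : modClass R) (P : lmodType R -> Prop).
Implicit Types T A B : lmodType R.

Definition classes_of : set (Vmon C) :=
  [set x | exists A (CA : C A), P A /\ x = V_class CA].

(** Membership in [C] is a premise: in a decomposition, [sum_of_iso] obtains it for the pieces from
    closure under summands. *)
Definition sum_of T := forall CT : C T, exists s : seq (Vmon C),
  (forall p, p \in s -> classes_of p) /\ V_class CT = \sum_(p <- s) p.

Lemma sum_of_iso T A B : mod_iso (A * B)%type T -> sum_of A -> sum_of B -> sum_of T.
Proof.
move=> iT dA dB CT; have CAB := class_iso (iso_sym iT) CT.
have CA := class_summand CAB; have CB := class_summand (class_iso (iso_sumC A B) CAB).
have [s [sP sE]] := dA CA; have [t [tP tE]] := dB CB.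
exists (s ++ t); split; first by move=> p; rewrite mem_cat => /orP[/sP|/tP].
rewrite big_cat -sE -tE; apply/esym; rewrite [LHS]V_classD.
exact/V_classP.
Qed.

Lemma sum_of_base T : P T -> sum_of T.
Proof.
move=> PT CT; exists [:: V_class CT]; rewrite big_seq1; split=> // p.
by rewrite mem_seq1 => /eqP ->; exists T, CT.
Qed.

Lemma zero_iso T : (forall x : T, x = 0) -> mod_iso T 'rV[R]_0.
Proof.
move=> T0; exists \0, (fun=> 0) => x; first by rewrite [RHS]T0.
by rewrite [RHS]thinmx0.
Qed.

Lemma sum_of0 T : (forall x : T, x = 0) -> sum_of T.
Proof.
move=> T0 CT; exists [::]; rewrite big_nil; split=> //.
exact/V_classP/zero_iso.
Qed.

End ClassSums.

Section TorsionDecomposition.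
Local Open Scope ring_scope.
Local Open Scope classical_set_scope.
Variable R : idomainType.
Implicit Types (T A B : lmodType R) (I : set R).
Local Notation loc_sum := (sum_of (tor_class R) (@loc_mod R)).

(** Endomorphisms of a cyclic module are multiplications by scalars, so f and g with sum 1 are r and
    1 - r, one of them invertible modulo [I]. *)
Lemma cyclic_loc_sum I T (x0 : T) : local_ideal I ->
  (forall r y, I r -> r *: (y : T) = 0) -> (forall y, exists r, y = r *: x0) ->
  loc_sum T.
Proof.
move=> [hI lI] IT genT; have [x00|x0N] := eqVneq x0 0.
  by apply: sum_of0 => y; have [r ->] := genT y; rewrite x00 scaler0.
apply: sum_of_base; split; first by exists x0.
move=> f g fg; have [r fx0] := genT (f x0).
have fE y : f y = r *: y.
  by have [t ->] := genT y; rewrite linearZ /= fx0 !scalerA mulrC.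
have gE y : g y = (1 - r) *: y.
  by rewrite scalerBl scale1r -fE -[X in _ = X - _](fg y) addrAC subrr add0r.
have bij (h : {linear T -> T}) q c : (forall y, h y = q *: y) -> I (1 - c * q) ->
    bijective h.
  move=> hE Icq; have cqE y : (c * q) *: (y : T) = y.
    by apply/eqP; rewrite eq_sym -subr_eq0 -{1}[y]scale1r -scalerBl IT.
  exists (fun y => c *: y) => y; first by rewrite hE scalerA.
  by rewrite hE scalerA mulrC.
by have [c [] /bij] := lI r; [left | right]; auto.
Qed.

Hypothesis R_prufer : prufer R.

Lemma local_comparable I x y : local_ideal I ->
  (exists t, I (y - t * x)) \/ (exists t, I (x - t * y)).
Proof.
move=> [hI lI]; have [a [b [c [e1 e2]]]] := prufer_pair R_prufer x y.
have [u [Iu|Iu]] := lI a; [left; exists (u * b) | right; exists (u * c)].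
  by rewrite -mulrA -e1 mulrA -{1}[y]mul1r -mulrBl mulrC; exact: idealM.
by rewrite -mulrA -e2 mulrA -{1}[x]mul1r -mulrBl mulrC; exact: idealM.
Qed.

Lemma seq_min (X : eqType) (le : X -> X -> Prop) (s : seq X) x0 :
  (forall x y, le x y \/ le y x) -> (forall y x z, le x y -> le y z -> le x z) ->
  x0 \in s -> exists2 x, x \in s & forall y, y \in s -> le x y.
Proof.
move=> tot tr; elim: s x0 => // x1 s IH x0 _.
have refl x : le x x by case: (tot x x).
case: s IH => [_|x2 s IH].
  by exists x1; rewrite ?mem_head // => y; rewrite mem_seq1 => /eqP ->.
have [x xs xmin] := IH x2 (mem_head _ _).
have [xx1|x1x] := tot x x1.
  exists x; first by rewrite in_cons xs orbT.
  by move=> y; rewrite in_cons => /orP[/eqP ->|/xmin].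
exists x1; first exact: mem_head.
by move=> y; rewrite in_cons => /orP[/eqP -> //|/xmin]; exact: tr.
Qed.

(* A pivot of the matrix [A] modulo the local ideal [I]: the combination
   [w = y0 *m A] of its rows satisfies [w = w j0 *: r] with [r j0 = 1], and
   [w j0] divides the column [j0]. *)
Lemma ex_pivot I m n (A : 'M[R]_(m, n.+1)) : local_ideal I ->
  exists (j0 : 'I_n.+1) (y0 : 'rV[R]_m) (r : 'rV[R]_n.+1),
  [/\ r 0 j0 = 1, forall j, I ((y0 *m A) 0 j0 * r 0 j - (y0 *m A) 0 j) &
      forall i, exists t, I (A i j0 - t * (y0 *m A) 0 j0)].
Proof.
move=> locI; have [hI _] := locI.
(* [None] stands for an extra entry 0, so that a minimum exists even without rows; if it is minimal,
   all entries of [A] lie in [I]. *)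
pose v (p : option ('I_m * 'I_n.+1)) := if p is Some ij then A ij.1 ij.2 else 0.
have [|||p _ pmin] := @seq_min _ (fun p q => exists t, I (v q - t * v p))
    (enum {: option ('I_m * 'I_n.+1)}) None.
- by move=> p q; exact: local_comparable.
- move=> q p k [t It] [u Iu]; exists (u * t).
  have -> : v k - u * t * v p = (v k - u * v q) + u * (v q - t * v p).
    by rewrite mulrBr addrA subrK mulrA.
  by apply: idealD => //; exact: idealM.
- by rewrite mem_enum.
have {}pmin q : exists t, I (v q - t * v p) by apply: pmin; rewrite mem_enum.
case: p pmin => [[i0 j0]|] pmin.
  have /choice[t tE] (j : 'I_n.+1) : exists t, I (A i0 j - t * A i0 j0).
    exact: (pmin (Some (i0, j))).
  have wE j : ((delta_mx 0 i0 : 'rV[R]_m) *m A) 0 j = A i0 j by rewrite -rowE mxE.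
  exists j0, (delta_mx 0 i0), (\row_j if j == j0 then 1 else t j); split.
  - by rewrite mxE eqxx.
  - move=> j; rewrite !wE mxE; case: eqP => [->|_].
      by rewrite mulr1 subrr; case: hI.
    by rewrite -opprB -mulN1r [A i0 j0 * _]mulrC; exact: idealM.
  - by move=> i; rewrite wE; exact: (pmin (Some (i, j0))).
have A0 i j : I (A i j) by have [t] := pmin (Some (i, j)); rewrite mulr0 subr0.
exists 0, 0, (\row_j (j == 0)%:R); split; first by rewrite mxE.
  by move=> j; rewrite mul0mx !mxE mul0r subrr; case: hI.
by move=> i; exists 0; rewrite mul0r subr0.
Qed.

(** Induction on the number of generators. The pivot vector r has coordinate 1 at [j0] and can
    replace that basis vector; all entries of column [j0] kill f r, so the cyclic module of f r
    splits off. The term [z] keeps the statement stable, since the relations of the complement are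
    also known only modulo [I]. *)
Lemma local_presentation_loc_sum I n T (f : {linear 'rV[R]_n -> T}) m (A : 'M[R]_(m, n)) :
  local_ideal I -> surj_lin f ->
  (forall x, f x = 0 <-> exists (y : 'rV[R]_m) (z : 'rV[R]_n), (forall j, I (z 0 j)) /\ x = y *m A + z) ->
  loc_sum T.
Proof.
move=> locI; have [hI _] := locI; have [I0 _] := hI.
elim: n T f A => [|n IH] T f A fs fk.
  by apply: sum_of0 => y; have [x <-] := fs y; rewrite [x]thinmx0 linear0.
have fI (z : 'rV[R]_n.+1) : (forall j, I (z 0 j)) -> f z = 0.
  by move=> Iz; apply/fk; exists 0, z; rewrite mul0mx add0r.
have fA (y : 'rV[R]_m) : f (y *m A) = 0.
  by apply/fk; exists y, 0; rewrite addr0; split=> // j; rewrite mxE.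
have IT r y : I r -> r *: (y : T) = 0.
  move=> Ir; have [x <-] := fs y; rewrite -linearZ; apply: fI => j.
  by rewrite mxE mulrC; exact: idealM.
have [j0 [y0 [r [r1 rI rdiv]]]] := ex_pivot A locI.
set a := (y0 *m A) 0 j0 in rI rdiv.
have ar : a *: f r = 0.
  rewrite -linearZ -[a *: r](subrK (y0 *m A)) linearD fA addr0; apply: fI => j.
  have -> : (a *: r - y0 *m A) 0 j = a * r 0 j - (y0 *m A) 0 j by rewrite !mxE.
  exact: rI.
have acol i : A i j0 *: f r = 0.
  have [t It] := rdiv i; rewrite -[A i j0](subrK (t * a)) scalerDl IT //.
  by rewrite -scalerA ar scaler0 addr0.
have ins_lin : linear (fun v : 'rV[R]_n =>
    \row_j (if unlift j0 j is Some k then v 0 k else 0) : 'rV[R]_n.+1).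
  by move=> c u v; apply/rowP => j; rewrite !mxE; case: unlift => [k|];
    rewrite ?mxE // mulr0 addr0.
pose ins := mk_linear ins_lin.
have ins0 (v : 'rV[R]_n) : ins v 0 j0 = 0 by rewrite mxE unlift_none.
have insl (v : 'rV[R]_n) k : ins v 0 (lift j0 k) = v 0 k by rewrite mxE liftK.
have ins_ex (v : 'rV[R]_n.+1) : v 0 j0 = 0 -> ins (\row_k v 0 (lift j0 k)) = v.
  move=> v0; apply/rowP => j; have [k ->|->] := unliftP j0 j.
    by rewrite insl mxE.
  by rewrite ins0.
have smul_lin : linear (fun c : 'rV[R]_1 => c 0 0 *: f r).
  by move=> c u v; rewrite !mxE scalerDl scalerA.
pose f1 := mk_linear smul_lin; pose f2 := f \o ins.
have [p1 [p1s p1E]] := img_proj f1; have [p2 [p2s p2E0]] := img_proj f2.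
have p1E' c : img_val f1 (p1 c) = c 0 0 *: f r by exact: p1E.
have p2E v : img_val f2 (p2 v) = f (ins v) by exact: p2E0.
have p2k v : p2 v = 0 <-> f (ins v) = 0.
  rewrite -p2E; split=> [->|]; first by rewrite linear0.
  exact/lin_inj0/img_val_inj.
(* [A] with column [j0] cleared by subtracting multiples of [r] from the rows. *)
pose A' : 'M[R]_(m, n) := \matrix_(i, k) (A i (lift j0 k) - A i j0 * r 0 (lift j0 k)).
have yA' (y : 'rV[R]_m) k : (y *m A') 0 k =
    (y *m A) 0 (lift j0 k) - (y *m A) 0 j0 * r 0 (lift j0 k).
  rewrite !mxE mulr_suml -sumrB; apply: eq_bigr => i _.
  by rewrite mxE mulrBr mulrA.
have addE (u v : 'rV[R]_n.+1) j : (u + v) 0 j = u 0 j + v 0 j by rewrite mxE.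
have scaleE c (v : 'rV[R]_n.+1) j : (c *: v) 0 j = c * v 0 j by rewrite mxE.
have oppE (v : 'rV[R]_n.+1) j : (- v) 0 j = - v 0 j by rewrite mxE.
have f_split c v : f (c *: r + ins v) = 0 -> c *: f r = 0 /\ p2 v = 0.
  move=> e; suff cr : c *: f r = 0.
    by split=> //; apply/p2k; rewrite linearD linearZ /= cr add0r in e.
  (* Coordinate [j0] of this relation shows that [c] is a combination of entries of column [j0] plus
     an element of [I], all of which kill f r. *)
  have /fk[y [z [Iz cE]]] := e.
  have -> : c = (y *m A) 0 j0 + z 0 j0.
    by rewrite -addE -cE addE scaleE r1 mulr1 ins0 addr0.
  rewrite scalerDl (IT (z 0 j0)) // addr0 mxE scaler_suml big1 // => i _.
  by rewrite -scalerA acol scaler0.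
have copE c w : lin_copair (img_val f1) (img_val f2) (p1 c, p2 w) =
    f (c 0 0 *: r + ins w).
  by rewrite linearD linearZ -[LHS]/(img_val f1 (p1 c) + img_val f2 (p2 w)) p1E' p2E.
apply: (@sum_of_iso _ _ _ _ (limg f1) (limg f2)).
- apply: (@inj_surj_iso _ _ _ (lin_copair (img_val f1) (img_val f2))).
    apply: lin_injP => -[u v]; have [c <-] := p1s u; have [w <-] := p2s v.
    rewrite copE => /f_split[cr w0]; congr pair => //.
    by apply: (@img_val_inj _ _ _ f1); rewrite p1E' linear0.
  move=> y; have [x <-] := fs y.
  exists (p1 (const_mx (x 0 j0)), p2 (\row_k (x - x 0 j0 *: r) 0 (lift j0 k))).
  rewrite copE ins_ex; last by rewrite addE oppE scaleE r1 mulr1 subrr.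
  by rewrite mxE addrC subrK.
- apply: (@cyclic_loc_sum I _ (p1 (const_mx 1))) => //.
    move=> c u Ic; apply: (@img_val_inj _ _ _ f1).
    by rewrite linearZ linear0 /= IT.
  move=> u; have [c <-] := p1s u; exists (c 0 0).
  apply: (@img_val_inj _ _ _ f1); by rewrite linearZ p1E' p1E' mxE /= scale1r.
- apply: (IH _ p2 A') => // v; rewrite p2k; split.
    move=> /fk[y [z [Iz vE]]]; exists y, (\row_k (z 0 (lift j0 k) - z 0 j0 * r 0 (lift j0 k))).
    split.
      move=> k; rewrite mxE; apply: idealB => //.
      by rewrite mulrC; exact: idealM.
    apply/rowP => k; rewrite -insl vE addE [RHS]mxE yA' [X in _ = _ + X]mxE.
    have yz : (y *m A) 0 j0 = - z 0 j0.
      by apply/eqP; rewrite -addr_eq0 -addE -vE ins0.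
    by rewrite yz mulNr opprK -addrA [X in _ = _ + X]addrC subrK.
  move=> [y [z [Iz ->]]]; rewrite linearD linearD.
  have -> : ins (y *m A') = y *m A - (y *m A) 0 j0 *: r.
    apply/rowP => j; have [k ->|->] := unliftP j0 j.
      by rewrite insl yA' addE oppE scaleE.
    by rewrite ins0 addE oppE scaleE r1 mulr1 subrr.
  rewrite linearB fA linearZ /= mxE scaler_suml big1 => [|i _].
    rewrite subrr add0r; apply: fI => j; have [k ->|->] := unliftP j0 j.
      by rewrite insl.
    by rewrite ins0.
  by rewrite -scalerA acol scaler0.
Qed.

Lemma local_loc_sum I T : local_ideal I -> (forall r y, I r -> r *: (y : T) = 0) ->
  loc_sum T.
Proof.
move=> locI IT CT; have [[m [n [g [f [fs fk]]]]] _] := CT.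
apply: (@local_presentation_loc_sum I n T f m (lin1_mx g)) => // x.
rewrite fk; split=> [[y <-]|[y [z [Iz ->]]]].
  exists y, 0; rewrite addr0 mul_rV_lin1; split=> // j.
  by rewrite mxE; case: locI => -[].
apply/fk; rewrite linearD mul_rV_lin1.
have -> : f (g y) = 0 by apply/fk; exists y.
rewrite add0r [z]row_sum_delta linear_sum big1 // => j _.
by rewrite linearZ /= IT.
Qed.

Lemma torsion_killed T : tor_class R T ->
  exists2 a, a != 0 & forall x : T, a *: x = 0.
Proof.
move=> [fT tT]; have [n [f fs]] := fp_fg fT.
have /choice[a aP] (i : 'I_n) : exists a, a != 0 /\ a *: f (delta_mx 0 i) = 0.
  by have [a a0 aE] := tT (f (delta_mx 0 i)); exists a.
exists (\prod_i a i); first by apply/prodf_neq0 => i _; case: (aP i).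
move=> x; have [v <-] := fs x; rewrite [v]row_sum_delta linear_sum scaler_sumr big1 // => i _.
rewrite linearZ scalerA mulrC -scalerA (bigD1 i) //= mulrC -scalerA.
by case: (aP i) => _ ->; rewrite !scaler0.
Qed.

(** On [T] the elements of [es] act as orthogonal idempotents with sum 1. The kernel of 1 - e is the
    image of e and is killed by a local ideal; its complement is killed by e, so the remaining
    elements still sum to the identity there. *)
Lemma idempotent_loc_sum (es : seq R) a T :
  (forall x : T, a *: x = 0) ->
  (forall x : T, (\sum_(e <- es) e) *: x = x) ->
  pairwise (fun e e' => `[<principal a (e * e')>]) es ->
  (forall e, e \in es -> local_ideal (ideal_adjoin (principal a) (1 - e))) ->
  loc_sum T.
Proof.
elim: es T => [|e es IH] T aT esT.
  by move=> _ _; apply: sum_of0 => x; rewrite -[x]esT big_nil scale0r.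
rewrite /= => /andP[/allP ees pes] locs.
have aT' c (x : T) : principal a c -> c *: x = 0.
  by move=> [d ->]; rewrite -scalerA aT scaler0.
have e_es (x : T) : (\sum_(e' <- es) e') *: (e *: x) = 0.
  rewrite scalerA mulr_suml scaler_suml big_seq big1 // => e' e'es.
  by rewrite mulrC; apply: aT'; exact/asboolP/ees.
have ee (x : T) : e *: (e *: x) = e *: x.
  by rewrite -[RHS]esT big_cons scalerDl e_es addr0.
have scale_lin (c : R) : linear (fun x : T => c *: x).
  by move=> b x y; rewrite scalerDr !scalerA mulrC.
pose q := mk_linear (scale_lin (1 - e)).
have qE x : q x = (1 - e) *: x by [].
have [p pE] : exists p : {linear T -> lker q}, forall x, ker_val q (p x) = e *: x.
  have [||p pE] := @lin_factor _ _ _ _ (ker_val q) (mk_linear (scale_lin e)); last by exists p.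
    exact: ker_val_inj.
  by move=> x; apply: ker_val_ex; rewrite qE mk_linearE scalerBl scale1r ee subrr.
have pK y : p (ker_val q y) = y.
  apply: (@ker_val_inj _ _ _ q); rewrite pE; have := ker_valP y.
  by rewrite qE scalerBl scale1r => /eqP; rewrite subr_eq0 => /eqP.
have pker y : e *: ker_val p y = 0 by rewrite -pE ker_valP linear0.
apply: (sum_of_iso (split_iso pK)).
  apply: (@local_loc_sum (ideal_adjoin (principal a) (1 - e))).
    by apply: locs; rewrite mem_head.
  move=> r y [i [s [ai ->]]]; apply: (@ker_val_inj _ _ _ q).
  rewrite linearZ linear0 /= scalerDl aT' // add0r -scalerA -qE ker_valP.
  by rewrite scaler0.
apply: (IH _ _ _ pes).
- by move=> x; apply: (@ker_val_inj _ _ _ p); rewrite linearZ linear0 /= aT.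
- move=> x; apply: (@ker_val_inj _ _ _ p); rewrite linearZ /=.
  by rewrite -[RHS]esT big_cons scalerDl pker add0r.
- by move=> e' e'es; apply: locs; rewrite in_cons e'es orbT.
Qed.

Lemma torsion_loc_sum T : h_local R -> loc_sum T.
Proof.
move=> R_hloc CT; have [a a0 aT] := torsion_killed CT.
have [es [[c cE] pes locs]] := hlocal_idempotents R_hloc a0.
apply: (@idempotent_loc_sum es a T) => // x.
apply/eqP; rewrite eq_sym -subr_eq0 -{1}[x]scale1r -scalerBl cE -scalerA aT.
by rewrite scaler0.
Qed.

End TorsionDecomposition.

(** * Decomposition of torsionless modules *)

Section FractionMatrices.
Local Open Scope ring_scope.
Variable R : idomainType.
Local Notation K := {fraction R}.
Local Notation tofrac := (@tofrac R).

Lemma common_den_mx m n (A : 'M[K]_(m, n)) :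
  exists2 d, d != 0 & exists B : 'M[R]_(m, n), map_mx tofrac B = tofrac d *: A.
Proof.
have [d d0 [l lE]] := common_den (fun ij : 'I_m * 'I_n => A ij.1 ij.2).
exists d => //; exists (\matrix_(i, j) l (i, j)); apply/matrixP => i j.
by rewrite !mxE -lE mulrC.
Qed.

Lemma map_tofrac_inj m n : injective (map_mx tofrac : 'M[R]_(m, n) -> 'M[K]_(m, n)).
Proof.
move=> A B /matrixP AB; apply/matrixP => i j.
by have := AB i j; rewrite !mxE => /(@tofrac_inj R).
Qed.

Lemma torsion_cokernel m n (A : 'M[R]_(m, n)) : exists D : 'M[R]_n,
  A *m D = 0 /\ forall x : 'rV[R]_n, x *m D = 0 ->
    exists2 e, e != 0 & exists y, e *: x = y *m A.
Proof.
pose B := map_mx tofrac A.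
have [d d0 [D DE]] := common_den_mx (cokermx B); exists D; split.
  apply: map_tofrac_inj; rewrite map_mxM DE -scalemxAr mulmx_coker scaler0.
  by rewrite map_mx0.
move=> x xD; have : map_mx tofrac x *m cokermx B = 0.
  have /(congr1 (map_mx tofrac)) := xD; rewrite map_mxM DE -scalemxAr map_mx0 => /eqP.
  by rewrite scaler_eq0 tofrac_eq0 (negbTE d0) => /eqP.
move=> /eqP; rewrite -submxE => /submxP[u uE].
have [e e0 [y yE]] := common_den_mx u; exists e => //; exists y.
by apply: map_tofrac_inj; rewrite map_mxM yE map_mxZ uE scalemxAl.
Qed.

Lemma free_inj_le m n (f : {linear 'rV[R]_m -> 'rV[R]_n}) : injective f -> (m <= n)%N.
Proof.
move=> f_inj; rewrite leqNgt; apply/negP => nm.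
pose B := map_mx tofrac (lin1_mx f).
have kB : kermx B != 0.
  by rewrite -mxrank_eq0 mxrank_ker subn_eq0 -ltnNge (leq_ltn_trans (rank_leq_col _)).
have [d d0 [w wE]] := common_den_mx (nz_row (kermx B)).
have wf : f w = 0.
  rewrite -mul_rV_lin1; apply: map_tofrac_inj; rewrite map_mxM wE -scalemxAl.
  have /submxP[u ->] := nz_row_sub (kermx B).
  by rewrite -mulmxA mulmx_ker mulmx0 scaler0 map_mx0.
have := lin_inj0 f_inj wf => w0; move: wE; rewrite w0 map_mx0 => /esym/eqP.
by rewrite scaler_eq0 tofrac_eq0 (negbTE d0) nz_row_eq0 (negbTE kB).
Qed.

End FractionMatrices.

Section Torsionless.
Local Open Scope ring_scope.
Local Open Scope classical_set_scope.
Variable R : idomainType.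
Implicit Types M N L A B : lmodType R.

Lemma lin_descend L M N (f : {linear L -> M}) (h : {linear L -> N}) :
  surj_lin f -> (forall x, f x = 0 -> h x = 0) ->
  exists q : {linear M -> N}, forall x, q (f x) = h x.
Proof.
move=> /choice[s sE] fh.
have hE x y : f x = f y -> h x = h y.
  move=> e; apply/eqP; rewrite -subr_eq0 -linearB; apply/eqP/fh.
  by rewrite linearB e subrr.
have ql : linear (h \o s).
  by move=> a x y; rewrite /= -linearP; apply: hE; rewrite linearP !sE.
by exists (mk_linear ql) => x; apply: hE; rewrite sE.
Qed.

Lemma row1E (v w : 'rV[R]_1) : v 0 0 = w 0 0 -> v = w.
Proof. by move=> e; apply/rowP => i; rewrite ord1. Qed.

(** [psi] identifies [N] with a nonzero finitely generated ideal, and the l_k are [d] times elements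
    of its inverse. *)
Lemma image_inverse N (psi : {linear N -> 'rV[R]_1}) :
  prufer R -> fin_generated N -> injective psi -> (exists x : N, x != 0) ->
  exists d m (u : 'I_m -> N) (l : 'I_m -> R), [/\ d != 0,
    \sum_k psi (u k) 0 0 * l k = d & forall x k, principal d (l k * psi x 0 0)].
Proof.
move=> R_pru [n [g gs]] psi_inj [x x0].
pose a (i : 'I_n) := psi (g (delta_mx 0 i)) 0 0.
have Ipsi y : gen_ideal a (psi y 0 0).
  have [v <-] := gs y; exists (fun i => v 0 i).
  rewrite {1}[v]row_sum_delta !linear_sum summxE; apply: eq_bigr => i _.
  by rewrite !linearZ mxE.
have /R_pru/invertible_inverse[d [m [b [l [d0 Ib bl lI]]]]] : gen_ideal a <> [set 0].
  move=> I0; case/eqP: x0; apply: (lin_inj0 psi_inj); apply: row1E.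
  by have := Ipsi x; rewrite I0 mxE.
have /choice[u uE] (k : 'I_m) : exists u, psi u 0 0 = b k.
  have [c ->] := Ib k; exists (\sum_i c i *: g (delta_mx 0 i)).
  by rewrite linear_sum summxE; apply: eq_bigr => i _; rewrite linearZ mxE.
exists d, m, u, l; split=> //; first by rewrite -bl; apply: eq_bigr => k _; rewrite uE.
by move=> y k; exact: lI.
Qed.

(** Elements l / d of the inverse ideal act as linear forms on [N]. *)
Lemma quotient_hom N (psi : {linear N -> 'rV[R]_1}) d l : d != 0 ->
  (forall x, principal d (l * psi x 0 0)) ->
  exists c : {linear N -> R^o}, forall x, l * psi x 0 0 = c x * d.
Proof.
move=> d0 /choice[c cE].
have cl : linear (c : N -> R^o).
  move=> r x y; apply: (mulIf d0); rewrite -cE linearP !mxE mulrDl mulrDr.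
  by rewrite mulrCA cE cE mulrA.
by exists (mk_linear cl).
Qed.

Lemma prufer_dual_basis N (psi : {linear N -> 'rV[R]_1}) :
  prufer R -> fin_generated N -> injective psi ->
  exists m (u : 'I_m -> N) (c : 'I_m -> {linear N -> R^o}),
    forall x, x = \sum_k c k x *: u k.
Proof.
move=> R_pru fN psi_inj.
have [N0|N0] := pselect (exists x : N, x != 0); last first.
  (* The zero ideal has no inverse; the zero module has the empty dual basis. *)
  exists 0%N, (fun=> 0), (fun=> \0) => x; rewrite big_ord0.
  by apply: contrapT => xN; apply: N0; exists x; apply/eqP.
have [d [m [u [l [d0 ul lI]]]]] := image_inverse R_pru fN psi_inj N0.
have [c cE] := choice (fun k => quotient_hom d0 (fun x => lI x k)).
exists m, u, c => x; apply: psi_inj; apply: row1E; rewrite linear_sum summxE.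
apply: (mulIf d0); rewrite mulr_suml -[in LHS]ul mulr_sumr; apply: eq_bigr => k _.
by rewrite linearZ mxE mulrAC -cE [LHS]mulrC -mulrA [LHS]mulrC.
Qed.

Lemma rank1_projective N (psi : {linear N -> 'rV[R]_1}) :
  prufer R -> fin_generated N -> injective psi -> fg_projective N.
Proof.
move=> R_pru fN psi_inj; split=> // A B p f ps.
have [m [u [c ucE]]] := prufer_dual_basis R_pru fN psi_inj.
have /choice[v vE] (k : 'I_m) : exists v, p v = f (u k) by exact: ps.
have hl : linear (fun x => \sum_k c k x *: v k).
  move=> a x y; rewrite scaler_sumr -big_split; apply: eq_bigr => k _ /=.
  by rewrite linearP scalerDl scalerA.
exists (mk_linear hl) => x; rewrite mk_linearE linear_sum [in RHS](ucE x) linear_sum.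
by apply: eq_bigr => k _; rewrite [LHS]linearZ [RHS]linearZ vE.
Qed.

(** Mutual embeddings with R^n define the rank without extending scalars; [free_inj_le] makes it
    unique. *)
Definition rk M n := (exists f : {linear 'rV[R]_n -> M}, injective f) /\
  (exists f : {linear M -> 'rV[R]_n}, injective f).

Lemma rk_uniq M m n : rk M m -> rk M n -> m = n.
Proof.
have le k l : rk M k -> rk M l -> (k <= l)%N.
  by move=> [[f f_inj] _] [_ [g g_inj]]; apply: (@free_inj_le R _ _ (g \o f)); exact: inj_comp.
by move=> hm hn; apply/eqP; rewrite eqn_leq !le.
Qed.

Lemma rk_iso M N n : mod_iso M N -> rk M n -> rk N n.
Proof.
move=> [h bh] [[f f_inj] [g g_inj]]; have [k [hK kK]] := lin_inverse bh; split.
  by exists (h \o f); apply: inj_comp (can_inj hK) f_inj.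
by exists (g \o k); apply: inj_comp g_inj (can_inj kK).
Qed.

Lemma rk_sum M N m n : rk M m -> rk N n -> rk (M * N)%type (m + n)%N.
Proof.
move=> [[f f_inj] [g g_inj]] [[f' f'_inj] [g' g'_inj]]; split.
  exists (mk_linear (row_pair_linear f f')); apply: lin_injP => x.
  rewrite mk_linearE /row_pair => -[/(lin_inj0 f_inj) l0 /(lin_inj0 f'_inj) r0].
  by rewrite -[x]hsubmxK l0 r0 row_mx0.
have hl : linear (fun x : (M * N)%type => row_mx (g x.1) (g' x.2)).
  by move=> a x y; rewrite /= !linearP scale_row_mx add_row_mx.
exists (mk_linear hl); apply: lin_injP => -[x y].
rewrite mk_linearE /= -[X in _ = X -> _]row_mx0 => /eq_row_mx[/(lin_inj0 g_inj) -> ].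
by move=> /(lin_inj0 g'_inj) ->.
Qed.

Lemma rk_free n : rk 'rV[R]_n n.
Proof. by split; exists idfun. Qed.

Lemma rk1P M (psi : {linear M -> 'rV[R]_1}) : injective psi ->
  (exists x : M, x != 0) -> rk M 1.
Proof.
move=> psi_inj [x x0]; split; last by exists psi.
have hl : linear (fun c : 'rV[R]_1 => c 0 0 *: x).
  by move=> a c d; rewrite !mxE scalerDl scalerA.
exists (mk_linear hl); apply: lin_injP => c; rewrite mk_linearE => cx.
apply: row1E; rewrite mxE.
have : psi x 0 0 != 0.
  apply: contra x0 => /eqP x0; apply/eqP/(lin_inj0 psi_inj)/row1E.
  by rewrite x0 mxE.
move=> /negbTE px; have /eqP := congr1 (fun v => psi v 0 0) cx.
by rewrite linearZ linear0 !mxE mulf_eq0 px orbF => /eqP.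
Qed.

(** The image of the first coordinate is a finitely generated ideal, hence projective, and splits
    off; the kernel embeds by the other coordinates. *)
Lemma torsionless_decomposition n M (phi : {linear M -> 'rV[R]_n}) :
  prufer R -> fin_generated M -> injective phi ->
  fg_projective M /\ sum_of (proj_class R) (fun N => rk N 1) M.
Proof.
move=> R_pru; elim: n M phi => [|n IH] M phi fM phi_inj.
  have M0 (x : M) : x = 0 by apply: (lin_inj0 phi_inj); exact: thinmx0.
  split; last exact: sum_of0.
  exact: fgp_iso (iso_sym (zero_iso M0)) (fgp_zero R).
have headl : linear (fun v : 'rV[R]_n.+1 => const_mx (v 0 0) : 'rV[R]_1).
  by move=> a u v; apply/rowP => i; rewrite !mxE.
have taill : linear (fun v : 'rV[R]_n.+1 => \row_i v 0 (lift 0 i) : 'rV[R]_n).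
  by move=> a u v; apply/rowP => i; rewrite !mxE.
pose pi : {linear M -> 'rV[R]_1} := mk_linear headl \o phi.
have tail_inj (v : 'rV[R]_n.+1) : v 0 0 = 0 -> mk_linear taill v = 0 -> v = 0.
  move=> v0 /rowP vt; apply/rowP => j; rewrite mxE.
  by have [k ->|->] := unliftP 0 j; [have := vt k; rewrite !mxE | ].
(* A coordinate that vanishes on [M] is dropped, since its image would not have rank one. *)
have [[x0 piN]|pi0] := pselect (exists x, pi x != 0); last first.
  apply: (IH M (mk_linear taill \o phi)) => //.
  apply: lin_injP => x /= /tail_inj xt; apply: (lin_inj0 phi_inj); apply: xt.
  have /eqP : pi x = 0 by apply: contrapT => /eqP xN; apply: pi0; exists x.
  by move=> /eqP/rowP/(_ 0); rewrite !mxE.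
have [p [ps pE]] := img_proj pi.
have pI := rank1_projective R_pru (limg_fg pi fM) (@img_val_inj _ _ _ pi).
have iM := projective_split pI.2 ps.
have fK : fin_generated (lker p) := fg_summand (fg_iso (iso_sym (iso_trans (iso_sumC _ _) iM)) fM).
have [|pK sK] := IH (lker p) (mk_linear taill \o phi \o ker_val p) fK.
  apply: lin_injP => y /= /tail_inj xt; apply: (lin_inj0 (@ker_val_inj _ _ _ p)).
  apply: (lin_inj0 phi_inj); apply: xt.
  have : pi (ker_val p y) = 0 by rewrite -pE ker_valP linear0.
  by move=> /rowP/(_ 0); rewrite !mxE.
split; first exact: fgp_iso iM (fgp_sum pI pK).
apply: (sum_of_iso iM) => //; apply: sum_of_base.
apply: (rk1P (@img_val_inj _ _ _ pi)); exists (p x0).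
by apply: contra piN => /eqP p0; rewrite -pE p0 linear0.
Qed.

Lemma projective_torsionless M : fg_projective M ->
  exists n (phi : {linear M -> 'rV[R]_n}), injective phi.
Proof.
move=> [[n [f fs]] pM]; have [s sE] := pM _ _ f idfun fs.
by exists n, s; exact: can_inj sE.
Qed.

Lemma projective_torsion_free M (x : M) a : fg_projective M -> a != 0 ->
  a *: x = 0 -> x = 0.
Proof.
move=> /projective_torsionless[n [phi phi_inj]] a0 ax.
apply: (lin_inj0 phi_inj); apply/rowP => j; rewrite mxE; apply: (mulfI a0).
by have /rowP/(_ j) := congr1 phi ax; rewrite linearZ linear0 !mxE mulr0.
Qed.

Lemma fp_split M : prufer R -> fp_class R M ->
  exists P T, [/\ proj_class R P, tor_class R T & mod_iso (P * T)%type M].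
Proof.
move=> R_pru fM; have [m [n [g [f [fs fk]]]]] := fM.
have [D [AD Dt]] := torsion_cokernel (lin1_mx g).
have hl : linear (fun x : 'rV[R]_n => x *m D).
  by move=> a x y; rewrite mulmxDl scalemxAl.
have [|q qE] := @lin_descend _ _ _ f (mk_linear hl) fs.
  by move=> x /fk[y <-]; rewrite mk_linearE -mul_rV_lin1 -mulmxA AD mulmx0.
have [p [ps pE]] := img_proj q.
have [pP _] := torsionless_decomposition R_pru (limg_fg q (fp_fg fM)) (@img_val_inj _ _ _ q).
have iM := projective_split pP.2 ps.
exists (limg q), (lker p); split=> //; split.
  exact: fp_summand (fp_iso (iso_sym (iso_trans (iso_sumC _ _) iM)) fM).
move=> y; have [x xE] := fs (ker_val p y).
have /Dt[e e0 [z zE]] : x *m D = 0.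
  by rewrite -[LHS]qE xE -pE ker_valP linear0.
exists e => //; apply: (lin_inj0 (@ker_val_inj _ _ _ p)).
rewrite linearZ -xE -linearZ; apply/fk; exists z.
by rewrite zE mul_rV_lin1.
Qed.

(** Maps from torsion modules to projective ones vanish, so an isomorphism and its inverse are
    triangular and their diagonal entries are inverse to each other. *)
Lemma proj_tor_cancel (P T P' T' : lmodType R) : fg_projective P -> fg_projective P' ->
  torsion T -> torsion T' -> mod_iso (P * T)%type (P' * T')%type ->
  mod_iso P P' /\ mod_iso T T'.
Proof.
move=> pP pP' tT tT' [f bf]; have [g [fK gK]] := lin_inverse bf.
have tor0 (X Y Q : lmodType R) (h : {linear X -> (Q * Y)%type}) x :
    fg_projective Q -> torsion X -> (h x).1 = 0.
  move=> pQ tX; have [r r0 rx] := tX x; apply: (projective_torsion_free pQ r0).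
  by have /(congr1 fst) := congr1 h rx; rewrite linearZ linear0.
have fT x : f (0, x) = (0, (f (0, x)).2).
  apply: pair_ext => //=.
  exact: (tor0 T T' P' (f \o lin_inr P T) x pP' tT).
have gT x : g (0, x) = (0, (g (0, x)).2).
  apply: pair_ext => //=.
  exact: (tor0 T' T P (g \o lin_inr P' T') x pP tT').
split.
  exists (lin_fst _ _ \o f \o lin_inl P T), (lin_fst _ _ \o g \o lin_inl P' T') => x.
    rewrite /= !mk_linearE.
    have -> : ((f (x, 0)).1, 0) = f (x, 0) - (0, (f (x, 0)).2) :> (P' * T')%type.
      by apply: pair_ext; rewrite /= ?subr0 ?subrr.
    by rewrite linearB fK gT /= subr0.
  rewrite /= !mk_linearE.
  have -> : ((g (x, 0)).1, 0) = g (x, 0) - (0, (g (x, 0)).2) :> (P * T)%type.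
    by apply: pair_ext; rewrite /= ?subr0 ?subrr.
  by rewrite linearB gK fT /= subr0.
exists (lin_snd _ _ \o f \o lin_inr P T), (lin_snd _ _ \o g \o lin_inr P' T') => x.
  by rewrite /= !mk_linearE -fT fK.
by rewrite /= !mk_linearE -gT gK.
Qed.

Lemma V_internal_product : prufer R ->
  internal_product (V_incl (@proj_fp R)) (V_incl (@tor_fp R)).
Proof.
move=> R_pru; elim/V_ind => M CM; have [P [T [pP tT iM]]] := fp_split R_pru CM.
exists (V_class pP, V_class tT); split.
  by rewrite !V_inclE [RHS]V_classD; apply/V_classP/iso_sym.
move=> [x y]; move: x y; elim/V_ind => P' pP'; elim/V_ind => T' tT' /=.
rewrite !V_inclE [X in _ = X]V_classD => /V_classP iM'.
have [iP iT] := proj_tor_cancel pP pP' tT.2 tT'.2 (iso_trans iM iM').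
by congr pair; apply/V_classP.
Qed.

End Torsionless.

(** * Rank one modules *)

Section RankOne.
Local Open Scope ring_scope.
Local Open Scope classical_set_scope.
Variable R : idomainType.
Implicit Types M N L : lmodType R.
Local Notation tofrac := (@tofrac R).

Section Colon.
Variables (N : lmodType R) (psi : {linear N -> 'rV[R]_1}) (d : R) (d0 : d != 0).
Variables (m : nat) (u : 'I_m -> N) (l : 'I_m -> R).
Hypothesis ul : \sum_k psi (u k) 0 0 * l k = d.

(* [d] times the inverse of the ideal [psi N]. *)
Definition colon_ideal : set R := [set x | forall y, principal d (x * psi y 0 0)].

Hypothesis lI : forall k, colon_ideal (l k).

Lemma colon_invertible : invertible_ideal colon_ideal.
Proof.
split.
  split=> [y|a x z Ix Iz y]; first by rewrite mul0r; case: (principal_ideal d).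
  by rewrite mulrDl -mulrA; case: (principal_ideal d) => _; apply.
exists [set z | exists x, z = tofrac (psi x 0 0) / tofrac d].
  split; first by exists 0; rewrite linear0 mxE tofrac0 mul0r.
  move=> a _ _ [x ->] [y ->]; exists (a *: x + y).
  by rewrite linearP !mxE rmorphD rmorphM /= mulrDl mulrA.
have d0' : tofrac d != 0 by rewrite tofrac_eq0.
apply/seteqP; split=> z.
  move=> [n [f [g [fI gJ ->]]]].
  have /choice[c cE] (i : 'I_n) : exists c, f i * g i = tofrac c.
    have [x Ix <-] := fI i; have [y ->] := gJ i; have [c cE] := Ix y.
    by exists c; rewrite mulrA -rmorphM /= cE rmorphM /= mulfK.
  by exists (\sum_i c i) => //; rewrite rmorph_sum; apply: eq_bigr => i _.
move=> [r _ <-]; exists m, (fun k => tofrac (l k)).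
exists (fun k => tofrac (psi (r *: u k) 0 0) / tofrac d); split.
- by move=> k; exists (l k).
- by move=> k; exists (r *: u k).
apply: (mulIf d0'); rewrite mulr_suml -rmorphM /= -ul mulr_sumr rmorph_sum.
apply: eq_bigr => k _; rewrite ul linearZ mxE -mulrA mulfVK //= !rmorphM /=.
by rewrite [RHS]mulrCA [X in _ = _ * X]mulrC.
Qed.

End Colon.

Hypothesis R_prufer : prufer R.

(* If [a] lies in the colon ideal [I'] of [M] but not in [rad I'], then
   [I' = R a + R x], and the homomorphisms attached to [x] and, on [N], to a
   multiple of [a] have jointly the value 1. *)
Lemma rank1_sum M N (phi : {linear M -> 'rV[R]_1}) (psi : {linear N -> 'rV[R]_1}) :
  one_and_half_generator R -> fin_generated M -> fin_generated N ->
  injective phi -> injective psi -> (exists x : M, x != 0) -> (exists x : N, x != 0) ->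
  exists L, mod_iso ('rV[R]_1 * L)%type (M * N)%type.
Proof.
move=> R_gen fM fN phi_inj psi_inj M0 N0.
have [d [m [u [l [d0 ul lI]]]]] := image_inverse R_prufer fM phi_inj M0.
have [e [n [v [k [e0 vk kJ]]]]] := image_inverse R_prufer fN psi_inj N0.
have [h hE] := choice (fun j => quotient_hom e0 (fun x => kJ x j)).
have hv : \sum_j h j (v j) = 1 :> R.
  apply: (mulIf e0); rewrite mulr_suml mul1r -[RHS]vk; apply: eq_bigr => j _.
  by rewrite -hE mulrC.
have ideal0 : ideal [set (0 : R)].
  by split=> // a x y /= -> ->; rewrite mulr0 addr0.
(* Any maximal ideal serves: the h_j (v_j) sum to 1, so one of them, [r], is outside [m0] and hence
   outside the Jacobson radical. *)
have [|m0 hm0 _] := ex_maximal_ideal ideal0.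
  by move=> /= /eqP; rewrite oner_eq0.
have [hm0i m01 _] := hm0.
have [j jm0] : exists j, ~ m0 (h j (v j)).
  apply: contrapT => nj; apply: m01; rewrite -hv; apply: ideal_sum => // j _.
  by apply: contrapT => hj; apply: nj; exists j.
set r := h j (v j) : R in jm0.
have lI' i : colon_ideal phi d (l i) by move=> y; exact: lI.
have hI' := colon_invertible d0 ul lI'.
(* If all r l_i were in the radical times the colon ideal, multiplying by phi (u_i), summing and
   dividing by [d] would put [r] into the radical. *)
have [i iN] : exists i, ~ set_mul (@jacobson_radical R) (colon_ideal phi d) (r * l i).
  apply: contrapT => ni; apply: jm0.
  have /choice[q qP] (i : 'I_m) : exists q, jacobson_radical q /\
      r * (phi (u i) 0 0 * l i) = q * d.
    have : set_mul (@jacobson_radical R) (colon_ideal phi d) (r * l i).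
      by apply: contrapT => hi; apply: ni; exists i.
    move=> [s [f [g [fJ gI fg]]]].
    have /choice[c cE] t : exists c, g t * phi (u i) 0 0 = c * d by exact: gI.
    exists (\sum_t f t * c t); split.
      move=> m' hm'; have [hm'i _ _] := hm'; apply: ideal_sum => // t _.
      by rewrite mulrC; apply: idealM => //; exact: fJ.
    rewrite mulrCA mulrC fg !mulr_suml; apply: eq_bigr => t _.
    by rewrite -!mulrA cE.
  have -> : r = \sum_i q i.
    apply: (mulIf d0); rewrite mulr_suml -{1}ul mulr_sumr; apply: eq_bigr => t _.
    by case: (qP t).
  by apply: ideal_sum => // t _; case: (qP t) => + _; apply.
have aI : colon_ideal phi d (r * l i) by exact: idealM hI'.1 (lI' i).
have a0 : r * l i != 0.
  apply/eqP => a0; apply: iN; rewrite a0; exists 0%N, (fun=> 0), (fun=> 0).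
  by rewrite big_ord0; split=> // -[].
have [x IE] := R_gen _ _ hI' (mulfI a0) aI iN.
have Ix : colon_ideal phi d x.
  by rewrite IE; exists 0, 1; rewrite mul0r mul1r add0r.
have [f fE] := quotient_hom d0 Ix.
have /choice[pq pqE] (t : 'I_m) : exists pq, l t = pq.1 * (r * l i) + pq.2 * x.
  by have := lI' t; rewrite {1}IE => -[p [q ->]]; exists (p, q).
(* Inserting the expressions of the l_t by r l_i and x into the sum [ul] and dividing by [d] gives f
   y + r c = 1. As r = h_j (v_j), the form given by f and h_j is 1 at (y, c v_j). *)
pose y := \sum_t (pq t).2 *: u t; pose y' := \sum_t (pq t).1 *: u t.
have [c cE] := lI' i y'.
have one : f y + r * c = 1.
  apply: (mulIf d0); rewrite mul1r mulrDl -fE -mulrA -cE -[RHS]ul.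
  rewrite /y /y' !linear_sum !summxE !mulr_sumr -big_split; apply: eq_bigr => t _ /=.
  rewrite !linearZ !mxE [in RHS]pqE mulrDr addrC; congr (_ + _).
    by rewrite [RHS]mulrCA [LHS]mulrA [LHS]mulrCA [X in _ = _ * X]mulrC.
  by rewrite [RHS]mulrCA [LHS]mulrCA [X in _ = _ * X]mulrC.
have pl : linear (fun z : (M * N)%type => const_mx (f z.1 + h j z.2) : 'rV[R]_1).
  move=> a z w; apply/rowP => t; rewrite !mxE /= !linearP.
  by rewrite mulrDr addrACA.
have sl : linear (fun z : 'rV[R]_1 => (z 0 0 *: y, (z 0 0 * c) *: v j) : (M * N)%type).
  move=> a z w; rewrite !mxE; apply: pair_ext => /=.
    by rewrite scalerDl scalerA.
  by rewrite scalerA mulrDl scalerDl mulrA.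
exists (lker (mk_linear pl)); apply: (@split_iso _ _ _ (mk_linear pl) (mk_linear sl)).
move=> z; apply: row1E; rewrite !mk_linearE mxE /= !linearZ /=.
rewrite -/r -[RHS]mulr1 -one mulrDr mulrA; congr (_ + _).
exact: mulrAC.
Qed.

(** * Determinants of maps from R^n + M to R^n + N *)

Section Determinant.
Variables (n : nat) (M N : lmodType R).
Variables (phi : {linear M -> 'rV[R]_1}) (psi : {linear N -> 'rV[R]_1}).
Variable F : {linear ('rV[R]_n * M)%type -> ('rV[R]_n * N)%type}.

Lemma row_embed_linear (L : lmodType R) (chi : {linear L -> 'rV[R]_1}) :
  linear (fun x : ('rV[R]_n * L)%type => row_mx x.1 (chi x.2)).
Proof. by move=> a x y; rewrite /= !linearP scale_row_mx add_row_mx. Qed.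

Definition row_embed (L : lmodType R) (chi : {linear L -> 'rV[R]_1}) :
  {linear ('rV[R]_n * L)%type -> 'rV[R]_(n + 1)} := mk_linear (row_embed_linear chi).

Definition col_rows : 'M[R]_(n, n + 1) :=
  lin1_mx (row_embed psi \o F \o lin_inl 'rV[R]_n M).

(* Over the fraction field this is the matrix of [F] in the bases given by
   [phi] and [psi], with its last row multiplied by [phi x]. *)
Definition col_mat (x : M) : 'M[R]_(n + 1) :=
  col_mx col_rows (row_embed psi (F (0, x))).

Lemma col_rowsE v : v *m col_rows = row_embed psi (F (v, 0)).
Proof. by rewrite mul_rV_lin1. Qed.

Hypothesis phi_inj : injective phi.

Lemma rank1_comm (L : lmodType R) (chi : {linear L -> 'rV[R]_1}) x y :
  injective chi -> chi x 0 0 *: y = chi y 0 0 *: x.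
Proof.
by move=> chi_inj; apply: chi_inj; apply: row1E; rewrite !linearZ !mxE mulrC.
Qed.

Lemma mx11_mul (p : nat) (a : 'rV[R]_1) (v : 'rV[R]_p) : a *m v = a 0 0 *: v.
Proof. by rewrite {1}[a]mx11_scalar mul_scalar_mx. Qed.

(** The determinant is proportional to [phi]: a factor phi c can be moved into the last row, and phi
    c times x equals phi x times c in [M]. *)
Lemma det_col_mat c x : phi c 0 0 * \det (col_mat x) = phi x 0 0 * \det (col_mat c).
Proof.
have E y z : phi y 0 0 * \det (col_mat z) =
    \det (col_mx col_rows (row_embed psi (F (0, phi y 0 0 *: z)))).
  have -> : phi y 0 0 = \det (block_mx (1%:M : 'M[R]_n) 0 0 (phi y)).
    by rewrite det_ublock det1 mul1r det_mx11.
  rewrite -det_mulmx mul_block_col !mul1mx !mul0mx addr0 add0r mx11_mul -!linearZ.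
  congr (\det (col_mx _ (row_embed psi (F _)))).
  by apply: pair_ext; rewrite /= ?scaler0 // det_ublock det1 mul1r det_mx11.
by rewrite !E (rank1_comm _ _ phi_inj).
Qed.

(** All entries of the last column lie in the ideal psi N; expand along it. *)
Lemma det_col_mat_mem x : exists y, psi y 0 0 = \det (col_mat x).
Proof.
have colE i : exists y, col_mat x i (rshift n 0) = psi y 0 0.
  rewrite -[i]splitK; case: split => k /=.
    exists (F (delta_mx 0 k, 0)).2.
    rewrite col_mxEu.
    have -> : col_rows k (rshift n 0) = ((delta_mx 0 k : 'rV[R]_n) *m col_rows) 0 (rshift n 0).
      by rewrite -rowE [RHS]mxE.
    by rewrite col_rowsE row_mxEr.
  by exists (F (0, x)).2; rewrite col_mxEd row_mxEr ord1.
have [y yE] := choice colE.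
exists (\sum_i cofactor (col_mat x) i (rshift n 0) *: y i).
rewrite linear_sum summxE (expand_det_col _ (rshift n 0)); apply: eq_bigr => i _.
by rewrite linearZ mxE yE mulrC.
Qed.

Lemma det_map : injective psi -> (exists x : M, x != 0) ->
  exists al : {linear M -> N}, forall x, psi (al x) 0 0 = \det (col_mat x).
Proof.
move=> psi_inj [c c0]; have [al alE] := choice det_col_mat_mem.
have pc : phi c 0 0 != 0.
  apply: contra c0 => /eqP c0; apply/eqP/(lin_inj0 phi_inj)/row1E.
  by rewrite c0 mxE.
suff al_lin : linear al by exists (mk_linear al_lin).
move=> a x y; apply: psi_inj; apply: row1E; apply: (mulfI pc).
rewrite alE (det_col_mat c) !linearP !mxE !alE mulrDl mulrDr -mulrA.
by rewrite -(det_col_mat c x) -(det_col_mat c y) mulrCA.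
Qed.

End Determinant.

(** Over the fraction field [F] and [G] have inverse matrices, but [col_mat phi G c'] has its last
    row scaled by b = psi c'. The matrix [D] scales the other rows by b too; the product is then b
    times a diagonal matrix, and [b ^+ n] cancels in the determinants. *)
Lemma det_comp n M N (phi : {linear M -> 'rV[R]_1}) (psi : {linear N -> 'rV[R]_1})
    (F : {linear ('rV[R]_n * M)%type -> ('rV[R]_n * N)%type})
    (G : {linear ('rV[R]_n * N)%type -> ('rV[R]_n * M)%type}) c c' :
  injective psi -> psi c' 0 0 != 0 -> cancel F G ->
  \det (col_mat psi F c) * \det (col_mat phi G c') = phi c 0 0 * psi c' 0 0.
Proof.
move=> psi_inj c'0 FK; set b := psi c' 0 0 in c'0 *.
pose D : 'M[R]_(n + 1) := block_mx b%:M 0 0 1%:M.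
have DB x : row_embed n psi x *m (D *m col_mat phi G c') = b *: row_embed n phi (G x).
  rewrite mul_block_col mul0mx mul1mx mul0mx addr0 add0r mul_scalar_mx mul_row_col.
  rewrite -scalemxAr col_rowsE mx11_mul -!linearZ -linearD -linearD.
  congr (row_embed n phi (G _)); apply: pair_ext => /=.
    by rewrite scaler0 addr0.
  by rewrite scaler0 add0r (rank1_comm _ _ psi_inj).
have AB : col_mat psi F c *m (D *m col_mat phi G c') =
    b *: block_mx 1%:M 0 0 (phi c).
  rewrite /col_mat mul_col_mx -/(col_mat phi G c') DB FK scale_col_mx; congr col_mx.
  apply/row_matrixP => i; rewrite row_mul rowE col_rowsE DB FK !linearZ /=.
  by rewrite mk_linearE /= linear0 row_row_mx row1 row0.
have := congr1 determinant AB.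
rewrite !det_mulmx detZ !det_ublock det1 det_scalar !det1 !mul1r mulr1 det_mx11.
have -> : b ^+ (n + 1) = b ^+ n * b by rewrite addn1 exprSr.
rewrite -mulrA mulrCA => /(mulfI (expf_neq0 n c'0)) ->.
by rewrite mulrC.
Qed.

(** On the ideals, [al] and [be] are multiplication by the determinants of [F] and of its inverse,
    which have product 1. *)
Lemma rank1_cancel n M N (phi : {linear M -> 'rV[R]_1}) (psi : {linear N -> 'rV[R]_1}) :
  injective phi -> injective psi -> (exists x : M, x != 0) -> (exists x : N, x != 0) ->
  mod_iso ('rV[R]_n * M)%type ('rV[R]_n * N)%type -> mod_iso M N.
Proof.
move=> phi_inj psi_inj M0 N0 [F bF]; have [G [FK GK]] := lin_inverse bF.
have [al alE] := det_map F phi_inj psi_inj M0.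
have [be beE] := det_map G psi_inj phi_inj N0.
have nz (L : lmodType R) (chi : {linear L -> 'rV[R]_1}) (x : L) :
    injective chi -> x != 0 -> chi x 0 0 != 0.
  move=> chi_inj; apply: contra => /eqP c0; apply/eqP/(lin_inj0 chi_inj)/row1E.
  by rewrite c0 mxE.
have [c cN] := M0; have [c' c'N] := N0.
have c0 := nz _ _ _ phi_inj cN; have c'0 := nz _ _ _ psi_inj c'N.
have detE := det_comp phi c psi_inj c'0 FK.
exists al, be => x.
  apply: (phi_inj); apply: row1E; apply: (mulfI (mulf_neq0 c0 c'0)).
  rewrite beE -mulrA (det_col_mat phi G psi_inj c') alE mulrA (det_col_mat psi F phi_inj c).
  by rewrite -mulrA detE mulrC.
apply: (psi_inj); apply: row1E; apply: (mulfI (mulf_neq0 c0 c'0)).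
rewrite alE mulrAC (det_col_mat psi F phi_inj c) beE mulrAC.
rewrite (mulrC (\det (col_mat phi G x))) (det_col_mat phi G psi_inj c').
by rewrite mulrAC -mulrA detE mulrC.
Qed.

End RankOne.

(** * The monoids of projective and torsion modules *)

Section ProjectiveMonoid.
Local Open Scope ring_scope.
Local Open Scope classical_set_scope.
Variable R : idomainType.
Hypothesis R_prufer : prufer R.
Local Notation V := (Vmon (proj_class R)).

Definition has_rank (x : V) n :=
  exists M (CM : proj_class R M), x = V_class CM /\ rk M n.

Lemma has_rankP M (CM : proj_class R M) n : has_rank (V_class CM) n <-> rk M n.
Proof.
split=> [[N [CN [/V_classP iMN rN]]]|]; last by exists M, CM.
exact: rk_iso (iso_sym iMN) rN.
Qed.

Lemma has_rank_uniq x m n : has_rank x m -> has_rank x n -> m = n.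
Proof. by elim/V_ind: x => M CM; rewrite !has_rankP; exact: rk_uniq. Qed.

Lemma has_rankD x y m n : has_rank x m -> has_rank y n -> has_rank (x + y) (m + n).
Proof.
elim/V_ind: x => M CM; elim/V_ind: y => N CN; rewrite V_classD !has_rankP.
exact: rk_sum.
Qed.

Lemma has_rank0 : has_rank 0 0.
Proof. exact/(has_rankP (class_zero (proj_class R)))/rk_free. Qed.

Lemma has_rank_eq0 x : has_rank x 0 -> x = 0.
Proof.
elim/V_ind: x => M CM /has_rankP[_ [f f_inj]]; apply/V_classP/zero_iso => x.
by apply: (lin_inj0 f_inj); exact: thinmx0.
Qed.

Lemma rank1_gen (x : V) : exists s : seq V,
  (forall g, g \in s -> has_rank g 1) /\ x = \sum_(g <- s) g.
Proof.
elim/V_ind: x => M CM; have [n [phi phi_inj]] := projective_torsionless CM.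
have [_ /(_ CM)[s [sP sE]]] := torsionless_decomposition R_prufer CM.1 phi_inj.
exists s; split=> // g /sP[N [CN [rN ->]]].
exact/has_rankP.
Qed.

Lemma has_rank_sum (s : seq V) : (forall g, g \in s -> has_rank g 1) ->
  has_rank (\sum_(g <- s) g) (size s).
Proof.
elim: s => [|g s IH] sP; first by rewrite big_nil; exact: has_rank0.
rewrite big_cons -[size _]add1n; apply: has_rankD; first exact/sP/mem_head.
by apply: IH => h hs; apply: sP; rewrite in_cons hs orbT.
Qed.

Lemma rank_ex x : exists n, has_rank x n.
Proof.
by have [s [sP ->]] := rank1_gen x; exists (size s); exact: has_rank_sum.
Qed.

Definition rank x : nat := sval (cid (rank_ex x)).

Lemma rankP x n : rank x = n <-> has_rank x n.
Proof.
rewrite /rank; case: cid => m xm /=; split=> [<- //|xn].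
exact: has_rank_uniq xm xn.
Qed.

Definition free_class n : V := @V_class R (proj_class R) _ (free_projective R n).

Lemma free_classMn n : free_class n = free_class 1 *+ n.
Proof.
elim: n => [|n IH]; first by rewrite mulr0n; apply/V_classP; exact: iso_refl.
rewrite mulrS -IH V_classD; apply/V_classP/iso_sym.
have hl : linear (fun x : ('rV[R]_1 * 'rV[R]_n)%type => row_mx x.1 x.2 : 'rV[R]_(1 + n)).
  by move=> a x y; rewrite /= scale_row_mx add_row_mx.
exists (mk_linear hl), (fun x : 'rV[R]_(1 + n) => (lsubmx x, rsubmx x)).
  by move=> [x y]; rewrite mk_linearE row_mxKl row_mxKr.
by move=> x; rewrite mk_linearE hsubmxK.
Qed.

Lemma rk1_inj (M : lmodType R) : rk M 1 ->
  (exists psi : {linear M -> 'rV[R]_1}, injective psi) /\ exists x : M, x != 0.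
Proof.
move=> [[f f_inj] [g g_inj]]; split; first by exists g.
exists (f (const_mx 1)); apply/eqP => /(lin_inj0 f_inj)/rowP/(_ 0).
by rewrite !mxE; apply/eqP; exact: oner_neq0.
Qed.

Lemma rank1_can n g h : has_rank g 1 -> has_rank h 1 ->
  free_class n + g = free_class n + h -> g = h.
Proof.
elim/V_ind: g => M CM; elim/V_ind: h => N CN.
move=> /has_rankP/rk1_inj[[phi phi_inj] M0] /has_rankP/rk1_inj[[psi psi_inj] N0].
rewrite !V_classD => /V_classP iMN; apply/V_classP.
exact: (rank1_cancel phi_inj psi_inj M0 N0 iMN).
Qed.

Lemma free_complement (x : V) : exists y n, x + y = free_class n.
Proof.
elim/V_ind: x => M CM; have [[n [f fs]] pM] := CM.
have iM := projective_split pM fs.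
have CK : proj_class R (lker f) :=
  fgp_summand (fgp_iso (iso_trans (iso_sym iM) (iso_sumC _ _)) (free_projective R n)).
by exists (V_class CK), n; rewrite V_classD; apply/V_classP.
Qed.

Hypothesis R_gen : one_and_half_generator R.

Lemma rank1_mul g h : has_rank g 1 -> has_rank h 1 ->
  exists2 k, has_rank k 1 & g + h = free_class 1 + k.
Proof.
elim/V_ind: g => M CM; elim/V_ind: h => N CN gM hN.
have [[phi phi_inj] M0] := rk1_inj (proj1 (has_rankP CM 1) gM).
have [[psi psi_inj] N0] := rk1_inj (proj1 (has_rankP CN 1) hN).
have [L iL] := rank1_sum R_prufer R_gen CM.1 CN.1 phi_inj psi_inj M0 N0.
have CL : proj_class R L :=
  fgp_summand (fgp_iso (iso_trans (iso_sym iL) (iso_sumC _ _)) (fgp_sum CM CN)).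
have sumE : V_class CM + V_class CN = free_class 1 + V_class CL.
  by rewrite !V_classD; apply/V_classP/iso_sym.
(* [rank1_sum] says nothing on the rank of [L]; additivity of the rank forces it to be 1. *)
exists (V_class CL) => //; have [k rkL] := rank_ex (V_class CL).
have rk1 : has_rank (free_class 1) 1 by apply/has_rankP/rk_free.
have := has_rankD rk1 rkL; rewrite -sumE => /(has_rank_uniq (has_rankD gM hN)).
by rewrite add1n => -[k1]; rewrite k1.
Qed.

Lemma projective_steinitz : steinitz V.
Proof.
apply: (@Steinitz V rank _ _ (free_class 1)).
- by move=> x y; apply/rankP/has_rankD; apply/rankP.
- by move=> x /rankP/has_rank_eq0.
- exact/rankP/has_rankP/rk_free.
- move=> x; have [s [sP ->]] := rank1_gen x; exists s; split=> // g /sP.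
  by move=> /rankP.
- move=> g h /rankP g1 /rankP h1; have [k k1 kE] := rank1_mul g1 h1.
  by exists k => //; exact/rankP.
- by move=> n g h /rankP g1 /rankP h1; rewrite -free_classMn; exact: rank1_can.
- move=> x; have [y [n xy]] := free_complement x; exists y, n.
  by rewrite xy free_classMn.
Qed.

End ProjectiveMonoid.

Section TorsionMonoid.
Local Open Scope ring_scope.
Local Open Scope classical_set_scope.
Variable R : idomainType.
Local Notation V := (Vmon (tor_class R)).
Local Notation P := (@classes_of R (tor_class R) (@loc_mod R)).

Lemma torsion_exchange (a b x y : V) : P a -> P b -> a + x = b + y ->
  (a = b /\ x = y) \/ exists z, y = a + z /\ x = b + z.
Proof.
move=> [A [CA [lA ->]]] [B [CB [lB ->]]].
elim/V_ind: x => X CX; elim/V_ind: y => Y CY.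
rewrite !V_classD => /V_classP/(iso_exchange lA lB)[[iAB iXY]|[Z [iY iX]]].
  by left; split; apply/V_classP.
have CZ := class_summand (class_iso (iso_trans iY (iso_sumC _ _)) CY).
right; exists (V_class CZ).
by rewrite !V_classD; split; apply/V_classP.
Qed.

Lemma torsion_local_nonzero (a x : V) : P a -> a + x <> 0.
Proof.
move=> [A [CA [[[c c0] _] ->]]]; elim/V_ind: x => X CX.
rewrite V_classD => /V_classP[f bf]; case/eqP: c0.
have e : ((c, 0) : (A * X)%type) = 0.
  by apply: (bij_inj bf); rewrite [LHS]thinmx0 [RHS]thinmx0.
by case: e.
Qed.

Lemma torsion_gen (x : V) : prufer R -> h_local R -> exists s : seq V,
  (forall p, p \in s -> P p) /\ x = \sum_(p <- s) p.
Proof. by move=> R_pru R_hloc; elim/V_ind: x => M CM; exact: torsion_loc_sum. Qed.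

End TorsionMonoid.

Theorem theorem5p3 (R : idomainType) (R_prufer : prufer R) :
  internal_product (V_incl (@proj_fp R)) (V_incl (@tor_fp R)) /\
  (one_and_half_generator R ->
    finitely_primary (Vmon (proj_class R)) 1 1 /\
    (h_local R ->
      [/\ free_abelian (Vmon (tor_class R)),
          half_factorial (Vmon (fp_class R)) &
          factorial_monoid (Vmon (fp_class R)) \/
          (catenary_degree (Vmon (fp_class R)) = Some 2 /\
           tame_degree (Vmon (fp_class R)) = Some 2)])).
Proof.
have prodV := V_internal_product R_prufer; split=> // R_gen.
have S := projective_steinitz R_prufer R_gen.
split=> [|R_hloc]; first exact: steinitz_finitely_primary S.
have exch := @torsion_exchange R.
have gen x := torsion_gen x R_prufer R_hloc.
have con := @torsion_local_nonzero R.
have [half deg] := product_factorizations prodV S exch gen con.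
by split=> //; exact: exchange_free exch gen con.
Qed.
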